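(* ${\sf C}\mbox{-}{\sf perm}\le_{m}^{p}{\sf planar}\mbox{-}{\sf C}\mbox{-}{\sf perm}$ and ${\sf C}\mbox{-}{\sf det}\le_{m}^{p}{\sf planar}\mbox{-}{\sf C}\mbox{-}{\sf det}$, and these polynomial-time many-one reductions work over any non-commutative algebra.
   Context: Let $R$ be an associative (possibly non-commutative) algebra with identity. For a weighted directed graph $G$ on $[n]$ with edge weights $w(i,j)\in R$ ($0$ for non-edges), ${\sf C}\mbox{-}{\sf perm}(G)=\sum_{\sigma\in S_n}w(1,\sigma(1))\cdots w(n,\sigma(n))$ and ${\sf C}\mbox{-}{\sf det}(G)=\sum_{\sigma\in S_n}{\rm sgn}(\sigma)w(1,\sigma(1))\cdots w(n,\sigma(n))$, products taken in this order. ${\sf C}\mbox{-}{\sf perm}$ (resp. ${\sf C}\mbox{-}{\sf det}$) is the problem of computing this value for a given weighted digraph, and ${\sf planar}\mbox{-}{\sf C}\mbox{-}{\sf perm}$ (resp. ${\sf planar}\mbox{-}{\sf C}\mbox{-}{\sf det}$) is the same problem restricted to planar weighted digraphs. $\le_m^p$ denotes a polynomial-time many-one reduction: a polynomial-time map sending $G$ to a planar weighted digraph $G'$ with the same Cayley permanent (resp. determinant). *)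

(* Defs.v *)
(* MathComp / MathComp-Analysis. *)
From mathcomp Require Import all_boot all_algebra all_fingroup.
From mathcomp Require Import all_classical reals topology normedtype.
From mathcomp Require Import Rstruct Rstruct_topology.
Import GRing.Theory Num.Theory numFieldNormedType.Exports.

Set Implicit Arguments.
Unset Strict Implicit.
Unset Printing Implicit Defensive.

Local Open Scope classical_set_scope.
Local Open Scope ring_scope.

(** * Weighted digraphs, Cayley permanent and Cayley determinant *)

(* The entry at (i, j) is w(i, j); an entry 0 means that i -> j is not an edge.
   The base field of an algebra plays no role below, so that coefficients are
   taken in an arbitrary associative ring with identity. *)
Definition wdigraph (R : pzRingType) (n : nat) : Type := 'M[R]_n.

(* \prod_(i < n) lists its factors in increasing order of i, which matters here
   because R need not be commutative. *)
Definition cperm (R : pzRingType) (n : nat) (G : wdigraph R n) : R :=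
  \sum_(s : 'S_n) \prod_(i < n) G i (s i).

(* The library defines \det by the Leibniz sum over an arbitrary ring, with the
   factors of each term in row order. *)
Definition cdet (R : pzRingType) (n : nat) (G : wdigraph R n) : R := \det G.

(** * Planarity *)

Local Notation RR := Rdefinitions.R.
Definition plane : Type := (RR * RR)%type.

Definition is_arc (f : RR -> plane) (p q : plane) : Prop :=
  [/\ {within `[0, 1], continuous f},
      {in `[0, 1]%R &, injective f}, f 0 = p & f 1 = q].

(* A simple graph is given by its edges {i, j}, recorded as e i j with i < j;
   the values e i j with j <= i are ignored. *)
Definition planar_graph (n : nat) (e : rel 'I_n) : Prop :=
  exists (pos : 'I_n -> plane) (arc : 'I_n -> 'I_n -> RR -> plane),
  [/\ injective pos,
      forall i j : 'I_n, (i < j)%N -> e i j ->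
        is_arc (arc i j) (pos i) (pos j),
      forall i j k : 'I_n, (i < j)%N -> e i j ->
        forall t : RR, 0 < t < 1 -> arc i j t <> pos k
    & forall i j k l : 'I_n, (i < j)%N -> e i j -> (k < l)%N -> e k l ->
        (i, j) <> (k, l) ->
        forall s t : RR, 0 < s < 1 -> 0 < t < 1 -> arc i j s <> arc k l t].

(* A digraph is planar when its underlying undirected simple graph is: loops,
   and the two orientations of an edge, can always be added to a drawing. *)
Definition planar_wdigraph (R : pzRingType) (n : nat) (G : wdigraph R n) :
    Prop :=
  planar_graph (fun i j => (G i j != 0) || (G j i != 0)).

(** * Polynomial-time computation over an arbitrary algebra

   Structured random access machine programs.  The memory has natural number
   cells and algebra cells, both with indirect addressing.  A program does not
   mention the algebra, so that the same program runs over all of them. *)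

Inductive instr : Type :=
| IConst of nat & nat
| IAdd of nat & nat & nat
| ISub of nat & nat & nat
| ILoad of nat & nat
| IStore of nat & nat
| AConst of nat & bool
| ACopy of nat & nat
| AOpp of nat & nat
| AAdd of nat & nat & nat
| AMul of nat & nat & nat.

Inductive test : Type :=
| TLeq of nat & nat
| TZero of nat.

Inductive prog : Type :=
| Skip
| Do of instr
| Seq of prog & prog
| If of test & prog & prog
| While of test & prog.

(* asize a is the size of an expression for aval a over the initial content of
   the memory. *)
Record state (R : pzRingType) : Type := State {
  cnt : nat -> nat;
  aval : nat -> R;
  asize : nat -> nat }.

Section Semantics.
Variable R : pzRingType.
Implicit Types (s : state R) (i : instr) (b : test) (p : prog).

Definition set_cnt s (x v : nat) : state R :=
  State [eta cnt s with x |-> v] (aval s) (asize s).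

Definition set_alg s (a : nat) (v : R) (k : nat) : state R :=
  State (cnt s) [eta aval s with a |-> v] [eta asize s with a |-> k].

Definition effect i s : state R :=
  let m := cnt s in let a := aval s in let z := asize s in
  match i with
  | IConst x c => set_cnt s x c
  | IAdd x y y' => set_cnt s x (m y + m y')
  | ISub x y y' => set_cnt s x (m y - m y')
  | ILoad x y => set_cnt s x (m (m y))
  | IStore x y => set_cnt s (m x) (m y)
  | AConst x c => set_alg s (m x) (if c then 1 else 0) 1
  | ACopy x y => set_alg s (m x) (a (m y)) (z (m y))
  | AOpp x y => set_alg s (m x) (- a (m y)) (z (m y))
  | AAdd x y y' => set_alg s (m x) (a (m y) + a (m y')) (z (m y) + z (m y'))
  | AMul x y y' => set_alg s (m x) (a (m y) * a (m y')) (z (m y) + z (m y'))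
  end.

(* Sums and products of algebra elements are charged the size of the result:
   with unit costs, repeated squaring would produce in polynomial time elements
   that have no representation of polynomial length. *)
Definition cost i s : nat :=
  match i with
  | AAdd _ y y' | AMul _ y y' =>
      (asize s (cnt s y) + asize s (cnt s y'))%N
  | _ => 1%N
  end.

Definition holds b s : bool :=
  match b with
  | TLeq x y => (cnt s x <= cnt s y)%N
  | TZero x => aval s (cnt s x) == 0
  end.

(* exec p s t s' : started in s, p halts after time t in s'. *)
Inductive exec : prog -> state R -> nat -> state R -> Prop :=
| ExecSkip s : exec Skip s 0 s
| ExecDo i s : exec (Do i) s (cost i s) (effect i s)
| ExecSeq p q s t s' t' s'' :
    exec p s t s' -> exec q s' t' s'' -> exec (Seq p q) s (t + t') s''
| ExecIfT b p q s t s' :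
    holds b s -> exec p s t s' -> exec (If b p q) s t.+1 s'
| ExecIfF b p q s t s' :
    ~~ holds b s -> exec q s t s' -> exec (If b p q) s t.+1 s'
| ExecWhileT b p s t s' t' s'' :
    holds b s -> exec p s t s' -> exec (While b p) s' t' s'' ->
    exec (While b p) s (t + t').+1 s''
| ExecWhileF b p s : ~~ holds b s -> exec (While b p) s 1 s.

Lemma exec_deterministic p s t1 s1 t2 s2 :
  exec p s t1 s1 -> exec p s t2 s2 -> t1 = t2 /\ s1 = s2.
Proof.
move=> e1; elim: e1 t2 s2 => {p s t1 s1};
  intros; match goal with H : exec _ _ ?t _ |- _ = ?t /\ _ => inversion H end;
  subst => //;
  repeat match goal with
  | IH : (forall t s', exec ?p ?s t s' -> _), H : exec ?p ?s _ _ |- _ =>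
      case: (IH _ _ H) => ? ?; subst; clear H
  | H : is_true (holds ?b ?s), H' : is_true (~~ holds ?b ?s) |- _ =>
      by rewrite H in H'
  end; by [].
Qed.

(* Input: n in counter 0, and w(i, j) in algebra cell i * n + j; all other
   cells contain 0. *)
Definition input (n : nat) (G : wdigraph R n) : state R :=
  State (fun x => if x == 0%N then n else 0%N)
        (fun a => \sum_(i < n) \sum_(j < n | a == (i * n + j)%N) G i j)
        (fun=> 1%N).

(* Output: the number of vertices in counter 0, and the weights row by row in
   the algebra cells that start at the address given by counter 1. *)
Definition output (s : state R) : wdigraph R (cnt s 0) :=
  \matrix_(i, j) aval s (cnt s 1 + i * cnt s 0 + j).

End Semantics.

(** * Problems and reductions *)

Record wproblem : Type := WProblem {
  instance_of : forall (R : pzRingType) (n : nat), wdigraph R n -> Prop;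
  value_of : forall (R : pzRingType) (n : nat), wdigraph R n -> R }.

Definition Cperm : wproblem := WProblem (fun R n _ => True) cperm.
Definition Cdet : wproblem := WProblem (fun R n _ => True) cdet.
Definition planar_Cperm : wproblem := WProblem planar_wdigraph cperm.
Definition planar_Cdet : wproblem := WProblem planar_wdigraph cdet.

(* The program and the time bound are the same for all algebras.  The number of
   entries of the output is counted in the running time: a program could
   otherwise announce a number of vertices exponential in its running time. *)
Definition ptime_many_one (A B : wproblem) : Prop :=
  exists (p : prog) (k : nat),
  forall (R : pzRingType) (n : nat) (G : wdigraph R n), instance_of A G ->
  exists (t : nat) (s : state R),
    [/\ exec p (input G) t s,
        (t + cnt s 0 * cnt s 0 <= n ^ k + k)%N,
        instance_of B (output s)
      & value_of B (output s) = value_of A G].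

(* Main.v *)
(* Fix a term w(1, s(1)) ... w(n, s(n)).  Row i chooses the column s(i); encode
   the choice by a chain of "row links" between consecutive cells (i, j - 1) and
   (i, j): the links left of cell (i, s(i)) are used by the cell on their left,
   the others by the cell on their right, and only the cell (i, s(i)) is left
   over to contribute w(i, s(i)).  Dually, chains of "column links" between
   (i - 1, j) and (i, j) ensure that each column is chosen exactly once.  A row
   link only occurs as a column, and a column link only as a row, of the
   resulting matrix, so that they may be identified in pairs in any way; pairing
   each row link with a column link that is incident to one of its two cells,
   one way above the diagonal and the other way below it, turns the matrix into
   the adjacency matrix of a subgraph of the square grid.  No cancellation is
   involved: cycle covers correspond bijectively to permutations, the remaining
   weights are 1 (or -1, for the determinant), and listing the cells row by row
   puts the factors w(i, s(i)) in the right order, whatever the algebra.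

   For the determinant, one of the two entries in the row and in the column of
   each link is -1, which makes the sign of a cycle cover equal to that of its
   permutation s.  Over the integers, two equal rows of G yield an explicit
   vector in the kernel of the new matrix, so that exchanging two values of s
   changes the sign; for s = 1 the cover is an involution, whose sign is
   computed directly. *)

From mathcomp Require Import all_boot all_order all_algebra all_fingroup.
From mathcomp Require Import zify ring lra.
From mathcomp Require Import all_classical reals topology normedtype.
From mathcomp Require Import Rstruct Rstruct_topology.
Require Import Defs.
Import Order.TTheory GRing.Theory Num.Theory numFieldNormedType.Exports.

Set Implicit Arguments.
Unset Strict Implicit.
Unset Printing Implicit Defensive.

Local Open Scope ring_scope.

Local Notation grid_size n := ((n * n).*2)%N.
Local Notation RR := Rdefinitions.R.

(** * The grid digraph *)

(* [vtx n i j false] is the cell (i, j), and [vtx n i j true] the vertex that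
   follows it: a link if [j.+1 < n], and an isolated vertex with a loop of
   weight 1, which only serves to make the numbering regular, if [j.+1 = n]. *)
Definition vtx (n i j : nat) (b : bool) : nat := ((i * n + j).*2 + b)%N.

Lemma vtx_half n i j b : (vtx n i j b)./2 = (i * n + j)%N.
Proof. by rewrite /vtx; case: b; lia. Qed.

Lemma vtx_odd n i j b : odd (vtx n i j b) = b.
Proof. by rewrite /vtx oddD odd_double; case: b. Qed.

Lemma vtx_row n i j b : (j < n)%N -> ((vtx n i j b)./2 %/ n)%N = i.
Proof.
move=> jn; rewrite vtx_half divnMDl; last by lia.
by rewrite divn_small ?addn0.
Qed.

Lemma vtx_col n i j b : (j < n)%N -> ((vtx n i j b)./2 %% n)%N = j.
Proof. by move=> jn; rewrite vtx_half modnMDl modn_small. Qed.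

Lemma vtx_inj n i j b i' j' b' : (j < n)%N -> (j' < n)%N ->
  vtx n i j b = vtx n i' j' b' -> [/\ i = i', j = j' & b = b'].
Proof.
move=> jn jn' e; split.
- by rewrite -(@vtx_row n i j b) // e vtx_row.
- by rewrite -(@vtx_col n i j b) // e vtx_col.
- by rewrite -(vtx_odd n i j b) e vtx_odd.
Qed.

Lemma vtx_lt n i j b : (i < n)%N -> (j < n)%N -> (vtx n i j b < grid_size n)%N.
Proof.
move=> li lj; have : ((i.+1 * n) <= n * n)%N by rewrite leq_mul2r li orbT.
by rewrite /vtx mulSn; case: b; lia.
Qed.

Variant vtx_spec n v : Prop :=
  VtxSpec i j b of (i < n)%N & (j < n)%N & v = vtx n i j b.

Lemma vtxP n v : (v < grid_size n)%N -> vtx_spec n v.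
Proof.
move=> lv; have n0 : (0 < n)%N by case: n lv.
have e := divn_eq v./2 n.
apply: (@VtxSpec n v (v./2 %/ n) (v./2 %% n) (odd v)).
- by rewrite ltn_divLR //; lia.
- by rewrite ltn_mod.
- by rewrite /vtx -e; lia.
Qed.

Lemma vtxBS n i j : (vtx n i j false).+1 = vtx n i j true.
Proof. by rewrite /vtx; lia. Qed.

Lemma vtxAS n i j : (vtx n i j true).+1 = vtx n i j.+1 false.
Proof. by rewrite /vtx; lia. Qed.

Lemma vtxAD n i j : (vtx n i j true + n.*2.+1 = vtx n i.+1 j.+1 false)%N.
Proof. by rewrite /vtx mulSn; lia. Qed.

Lemma vtxBD n i j : (vtx n i j false + n.*2.+1 = vtx n i.+1 j true)%N.
Proof. by rewrite /vtx mulSn; lia. Qed.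

(* [KNeg] stands for the weight 1 for the permanent and -1 for the determinant. *)
Inductive kind := KZero | KOne | KNeg | KWeight.

Definition kind_at (n i j : nat) (b : bool) (v u : nat) : kind :=
  if b then
    if j.+1 == n then (if u == v then KOne else KZero)
    else if (i <= j)%N then
      (if u == v.+1 then KOne
       else if u == (v + n.*2.+1)%N then KNeg else KZero)
    else
      (if u.+1 == v then KNeg
       else if (u + n.*2.+1)%N == v then KOne else KZero)
  else
    if u == v then KWeight
    else if (u.+1 == v) && (0 < j)%N then KNeg
    else if (u == v.+1) && (j.+1 < n)%N then KOne else KZero.

Definition kind_of (n v u : nat) : kind :=
  kind_at n (v./2 %/ n) (v./2 %% n) (odd v) v u.

Lemma kind_vtx n i j b u : (j < n)%N ->
  kind_of n (vtx n i j b) u = kind_at n i j b (vtx n i j b) u.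
Proof. by move=> jn; rewrite /kind_of vtx_row // vtx_col // vtx_odd. Qed.

(* The vertex identified with the column link between (r - 1, c) and (r, c).  As
   a row link, it lies to the left of (r - 1, c) if [r <= c], and to the right
   of (r, c) otherwise. *)
Definition link n r c :=
  if (r <= c)%N then vtx n r.-1 c.-1 true else vtx n r c true.

Lemma link_lt n r c : (0 < r < n)%N -> (c < n)%N -> (link n r c < grid_size n)%N.
Proof. by move=> hr hc; rewrite /link; case: (leqP r c) => h; apply: vtx_lt; lia. Qed.

Lemma link_inj n r c r' c' : (0 < r < n)%N -> (c < n)%N ->
  (0 < r' < n)%N -> (c' < n)%N ->
  link n r c = link n r' c' -> r = r' /\ c = c'.
Proof.
move=> hr hc hr' hc'; rewrite /link; case: (leqP r c) => h; case: (leqP r' c') => h';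
  by case/vtx_inj; lia.
Qed.

Lemma vtx_link n i j : (i < n)%N -> (j.+1 < n)%N ->
  vtx n i j true = if (i <= j)%N then link n i.+1 j.+1 else link n i j.
Proof.
by move=> li lj; rewrite /link; case: (leqP i j) => h; [rewrite ifT|].
Qed.

Lemma kind_link n r c u : (0 < r < n)%N -> (c < n)%N ->
  kind_of n (link n r c) u =
  if u == vtx n r.-1 c false then KOne
  else if u == vtx n r c false then KNeg else KZero.
Proof.
move=> hr hc; rewrite /link; case: (leqP r c) => h; rewrite kind_vtx; try lia.
all: rewrite /kind_at ifF; last by lia.
  rewrite ifT; last by lia.
  by rewrite vtxAS vtxAD !prednK //; lia.
rewrite ifF; last by lia.
rewrite -vtxBS eqSS vtxBS; have -> : vtx n r c true = (vtx n r.-1 c false + n.*2.+1)%N.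
  by rewrite vtxBD prednK //; lia.
rewrite eqn_add2r; case: eqP => [->|//]; case: eqP => // /vtx_inj[]; lia.
Qed.

Lemma odd_link n r c : odd (link n r c).
Proof. by rewrite /link; case: ifP => _; rewrite vtx_odd. Qed.

Lemma link_eqF n r c i j : (link n r c == vtx n i j false) = false.
Proof. by apply/eqP => /(congr1 odd); rewrite odd_link vtx_odd. Qed.

Lemma link_eq n r c r' c' : (0 < r < n)%N -> (c < n)%N ->
  (0 < r' < n)%N -> (c' < n)%N ->
  (link n r c == link n r' c') = (r == r') && (c == c').
Proof.
move=> hr hc hr' hc'; apply/eqP/andP => [/(link_inj hr hc hr' hc')[-> ->]//|].
by case=> /eqP -> /eqP ->.
Qed.

Variant grid_spec n : nat -> Prop :=
| GridCell i j of (i < n)%N & (j < n)%N : grid_spec n (vtx n i j false)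
| GridLink r c of (0 < r < n)%N & (c < n)%N : grid_spec n (link n r c)
| GridDummy i of (i < n)%N : grid_spec n (vtx n i n.-1 true).

Lemma gridP n v : (v < grid_size n)%N -> grid_spec n v.
Proof.
case/vtxP=> i j [] li lj ->; last exact: GridCell.
have [e|ne] := eqVneq j.+1 n.
  by have -> : j = n.-1 by [lia]; apply: GridDummy.
by rewrite vtx_link; try lia; case: ifP => h; apply: GridLink; lia.
Qed.

Lemma support_block n i j u : (i < n)%N -> (j < n)%N ->
  kind_of n (vtx n i j false) u <> KZero ->
  [\/ u = vtx n i j false, (0 < j)%N /\ u = vtx n i j.-1 true |
      (j.+1 < n)%N /\ u = vtx n i j true].
Proof.
move=> li lj; rewrite kind_vtx // /kind_at.
case: eqP => [-> _|_]; first exact: Or31.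
case: andP => [[/eqP e j0] _|_].
  by apply: Or32; split=> //; apply: succn_inj; rewrite e vtxAS prednK.
by case: andP => // -[/eqP -> lj1] _; apply: Or33; rewrite vtxBS.
Qed.

Lemma support_link n r c u : (0 < r < n)%N -> (c < n)%N ->
  kind_of n (link n r c) u <> KZero ->
  u = vtx n r.-1 c false \/ u = vtx n r c false.
Proof.
move=> hr hc; rewrite kind_link //.
by case: eqP => [->|_]; [left|case: eqP => [->|//]; right].
Qed.

Lemma support_dummy n i u : (i < n)%N ->
  kind_of n (vtx n i n.-1 true) u <> KZero -> u = vtx n i n.-1 true.
Proof.
move=> li; have n0 : (0 < n)%N by lia.
by rewrite kind_vtx /kind_at ?prednK ?eqxx //; case: eqP.
Qed.

(** * Cycle covers and permutations *)

(* The cycle cover of a permutation [s] with inverse [k]. *)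
Definition flow_at (n : nat) (s k : nat -> nat) (i j : nat) (b : bool)
    (v : nat) : nat :=
  if b then
    if j.+1 == n then v
    else if (i <= j)%N then
      (if (i < k j.+1)%N then v.+1 else (v + n.*2.+1)%N)
    else
      (if (i <= k j)%N then (v - n.*2.+1)%N else v.-1)
  else
    if (j < s i)%N then v.+1 else if j == s i then v else v.-1.

Definition flow (n : nat) (s k : nat -> nat) (v : nat) : nat :=
  flow_at n s k (v./2 %/ n) (v./2 %% n) (odd v) v.

Lemma flow_vtx n s k i j b : (j < n)%N ->
  flow n s k (vtx n i j b) = flow_at n s k i j b (vtx n i j b).
Proof. by move=> jn; rewrite /flow vtx_row // vtx_col // vtx_odd. Qed.

Section Flow.
Variables (n : nat) (s k : nat -> nat).
Hypothesis s_lt : forall i, (i < n)%N -> (s i < n)%N.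
Hypothesis k_lt : forall j, (j < n)%N -> (k j < n)%N.
Hypothesis sK : forall i, (i < n)%N -> k (s i) = i.
Hypothesis kK : forall j, (j < n)%N -> s (k j) = j.

Variant flow_spec i j : bool -> nat -> kind -> Prop :=
| FlowRight of (j < s i)%N & (j.+1 < n)%N :
    flow_spec i j false (vtx n i j true) KOne
| FlowSelf of j = s i : flow_spec i j false (vtx n i j false) KWeight
| FlowLeft of (s i < j)%N : flow_spec i j false (vtx n i j.-1 true) KNeg
| FlowDummy of j.+1 = n : flow_spec i j true (vtx n i j true) KOne
| FlowUpper1 of (i <= j)%N & (j.+1 < n)%N & (i < k j.+1)%N :
    flow_spec i j true (vtx n i j.+1 false) KOne
| FlowUpper2 of (i <= j)%N & (j.+1 < n)%N & (k j.+1 <= i)%N :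
    flow_spec i j true (vtx n i.+1 j.+1 false) KNeg
| FlowLower1 of (j < i)%N & (i <= k j)%N :
    flow_spec i j true (vtx n i.-1 j false) KOne
| FlowLower2 of (j < i)%N & (k j < i)%N :
    flow_spec i j true (vtx n i j false) KNeg.

Lemma flowP i j b : (i < n)%N -> (j < n)%N ->
  flow_spec i j b (flow n s k (vtx n i j b))
    (kind_of n (vtx n i j b) (flow n s k (vtx n i j b))).
Proof.
move=> li lj; rewrite kind_vtx // flow_vtx // /flow_at /kind_at.
case: b.
  case: (eqVneq j.+1 n) => [e|ne]; first by rewrite eqxx; exact: FlowDummy.
  have lj1 : (j.+1 < n)%N by lia.
  case: (leqP i j) => ij.
    case: (ltnP i (k j.+1)) => hk; first by rewrite eqxx vtxAS; apply: FlowUpper1.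
    rewrite vtxAD ifF; first by rewrite eqxx; exact: FlowUpper2.
    by apply/eqP; rewrite vtxAS => /vtx_inj[//|//|]; lia.
  case: (leqP i (k j)) => hk.
    have -> : (vtx n i j true - n.*2.+1)%N = vtx n i.-1 j false.
      by case: i li ij hk => // i *; rewrite -vtxBD addnK.
    rewrite ifF; last by apply/eqP; rewrite vtxBS => /vtx_inj[//|//|]; lia.
    rewrite ifT; first by apply: FlowLower1.
    by rewrite vtxBD prednK //; lia.
  have -> : (vtx n i j true).-1 = vtx n i j false by rewrite -vtxBS.
  by rewrite vtxBS eqxx; apply: FlowLower2.
case: (ltngtP j (s i)) => h.
- have lj1 : (j.+1 < n)%N by have := s_lt li; lia.
  rewrite ifF; last by lia.
  rewrite ifF; last by lia.
  by rewrite eqxx lj1 /= vtxBS; apply: FlowRight.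
- have -> : (vtx n i j false).-1 = vtx n i j.-1 true.
    by case: j lj h => // j *; rewrite -vtxAS.
  rewrite ifF; last by apply/eqP => /vtx_inj[||] //; lia.
  rewrite ifT; first by apply: FlowLeft.
  by rewrite vtxAS prednK ?eqxx //; lia.
- by rewrite eqxx; apply: FlowSelf.
Qed.

Lemma flow_lt v : (v < grid_size n)%N -> (flow n s k v < grid_size n)%N.
Proof.
case/vtxP=> i j b li lj ->.
by case: flowP => // *; apply: vtx_lt; lia.
Qed.

Lemma flow_inj u v : (u < grid_size n)%N -> (v < grid_size n)%N ->
  flow n s k u = flow n s k v -> u = v.
Proof.
case/vtxP=> i j b li lj -> /vtxP[i' j' b' li' lj' ->].
have [e e'] := (sK li, sK li').
case: flowP => //; case: flowP => // *;
 match goal with H : vtx _ _ _ _ = vtx _ _ _ _ |- _ =>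
   case/vtx_inj: H; [by lia | by lia |]; move=> *
  end; subst;
 repeat match goal with
 | H : s _ = _ |- _ => rewrite {}H in e e'
 | H : _ = s _ |- _ => rewrite -{}H in e e'
 | H : _.+1 = _.+1 |- _ => case: H => ?; subst
 end;
 try first [by [] | by exfalso; lia | by congr vtx; lia].
Qed.
End Flow.

Lemma find_threshold n (P : pred nat) :
  (forall j, (j.+1 < n)%N -> P j.+1 -> P j) -> ~~ P n.-1 -> (0 < n)%N ->
  let m := find (predC P) (iota 0 n) in
  (m < n)%N /\ forall j, (j < n)%N -> P j = (j < m)%N.
Proof.
move=> mono nP n0 m.
have nth0 j : (j < n)%N -> nth 0%N (iota 0 n) j = j by move=> lj; rewrite nth_iota.
have has_m : has (predC P) (iota 0 n).
  by apply/hasP; exists n.-1 => //; rewrite mem_iota; lia.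
have lm : (m < n)%N by rewrite -[X in (_ < X)%N](size_iota 0 n) -has_find.
split=> // j lj; case: ltnP => h.
  by move: (before_find 0%N h); rewrite nth0 //= => /negbFE.
apply/negbTE; elim: j h lj => [|j IH] h lj.
  by move: (nth_find 0%N has_m); rewrite -/m nth0 //=; have -> : m = 0%N by lia.
have [e|lt] := eqVneq m j.+1.
  by move: (nth_find 0%N has_m); rewrite -/m nth0 //= e.
by apply/negP => /(mono _ lj); apply/negP; apply: IH; lia.
Qed.

Section Converse.
Variables (n : nat) (t : nat -> nat).
Let N := grid_size n.
Hypothesis n_gt0 : (0 < n)%N.
Hypothesis t_inj : forall u v, (u < N)%N -> (v < N)%N -> t u = t v -> u = v.
Hypothesis t_onto : forall u, (u < N)%N -> exists2 v, (v < N)%N & t v = u.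
Hypothesis t_supp : forall v, (v < N)%N -> kind_of n v (t v) <> KZero.

Let B i j := vtx n i j false.
Let A i j := vtx n i j true.

Lemma tB i j : (i < n)%N -> (j < n)%N ->
  [\/ t (B i j) = B i j, (0 < j)%N /\ t (B i j) = A i j.-1 |
      (j.+1 < n)%N /\ t (B i j) = A i j].
Proof. by move=> li lj; apply: support_block => //; apply/t_supp/vtx_lt. Qed.

Lemma tlink r c : (0 < r < n)%N -> (c < n)%N ->
  t (link n r c) = B r.-1 c \/ t (link n r c) = B r c.
Proof. by move=> hr hc; apply: support_link => //; apply/t_supp/link_lt. Qed.

Lemma tdummy i : (i < n)%N -> t (A i n.-1) = A i n.-1.
Proof. by move=> li; apply: support_dummy => //; apply/t_supp/vtx_lt => //; lia. Qed.

Lemma A_covered i j : (i < n)%N -> (j.+1 < n)%N ->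
  t (B i j) = A i j \/ t (B i j.+1) = A i j.
Proof.
move=> li lj; have [|v lv] := @t_onto (A i j); first by apply: vtx_lt => //; lia.
case: (gridP lv) => [i' j' li' lj'|r c hr hc|i' li'] e.
- case: (tB li' lj') => [|[j0]|[j1]] et; move: e (e); rewrite {1}[t _]et.
  + by case/vtx_inj=> //; lia.
  + case/vtx_inj=> //; [lia|lia|move=> -> e2 _]; right.
    by rewrite -e -e2 prednK.
  + by case/vtx_inj=> //; [lia|move=> -> ->]; left.
- by case: (tlink hr hc); rewrite e => /vtx_inj[]//; lia.
- by move: (tdummy li'); rewrite e => /vtx_inj[]; lia.
Qed.

Lemma B_covered i j : (i < n)%N -> (j < n)%N ->
  [\/ t (B i j) = B i j, (0 < i)%N /\ t (link n i j) = B i j |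
      (i.+1 < n)%N /\ t (link n i.+1 j) = B i j].
Proof.
move=> li lj; have [|v lv] := @t_onto (B i j); first by apply: vtx_lt.
case: (gridP lv) => [i' j' li' lj'|r c hr hc|i' li'] e.
- case: (tB li' lj') => [|[j0]|[j1]] et; move: e (e); rewrite {1}[t _]et.
  + by case/vtx_inj=> // -> -> _; apply: Or31.
  + by case/vtx_inj=> //; lia.
  + by case/vtx_inj=> //; lia.
- case: (tlink hr hc) => et; move: e (e); rewrite {1}et.
    case/vtx_inj=> // ri cj _ e; subst; apply: Or33; rewrite prednK //; last lia.
    by split=> //; lia.
  by case/vtx_inj=> // ri cj _ e; subst; apply: Or32; split=> //; lia.
- by move: (tdummy li'); rewrite e => /vtx_inj[]//; lia.
Qed.

Lemma link_neq r c i j : link n r c <> B i j.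
Proof. by apply/eqP; rewrite link_eqF. Qed.

(* [goR i] and [goU c] hold on initial segments of the indices, whose lengths
   define the permutation and its inverse. *)
Let goR i j := t (B i j) == A i j.
Let goU c r := (r.+1 < n)%N && (t (link n r.+1 c) == B r c).
Let s i := find (predC (goR i)) (iota 0 n).
Let k c := find (predC (goU c)) (iota 0 n).

Lemma exitP i : (i < n)%N ->
  (s i < n)%N /\ forall j, (j < n)%N -> goR i j = (j < s i)%N.
Proof.
move=> li; apply: find_threshold => // [j lj /eqP e|].
  apply/eqP; case: (A_covered li lj) => // e'.
  by move: e; rewrite e' => /vtx_inj[]; lia.
have ln : (n.-1 < n)%N by lia.
apply/eqP => e; case: (tB li ln) => [|[]|[]]; rewrite ?e.
- by case/vtx_inj.
- by move=> j0 /vtx_inj[]; lia.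
- by lia.
Qed.

Lemma entryP c : (c < n)%N ->
  (k c < n)%N /\ forall r, (r < n)%N -> goU c r = (r < k c)%N.
Proof.
move=> lc; apply: find_threshold => // [r lr /andP[lr' /eqP e]|].
  apply/andP; split=> //; apply/eqP; case: (@tlink r.+1 c) => // e'.
  have := t_inj _ _ (etrans e' (esym e)).
  by move=> /(_ (link_lt _ _) (link_lt _ _)) /link_inj; lia.
by rewrite /goU prednK // ltnn.
Qed.

Lemma BN i j : (i < n)%N -> (j < n)%N -> (B i j < N)%N.
Proof. exact: vtx_lt. Qed.

Lemma tB_lt i j : (i < n)%N -> (j < n)%N -> (j < s i)%N -> t (B i j) = A i j.
Proof. by move=> li lj; have [_ h] := exitP li; rewrite -h // => /eqP. Qed.

Lemma tB_eq i : (i < n)%N -> t (B i (s i)) = B i (s i).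
Proof.
move=> li; have [ls h] := exitP li.
case: (tB li ls) => // [[s0 e]|[_ /eqP]]; last by rewrite -/(goR _ _) h // ltnn.
have e' : t (B i (s i).-1) = A i (s i).-1 by apply: tB_lt; lia.
have := t_inj (BN li ls) (BN li _) (etrans e (esym e')).
by move=> /(_ (ltac:(lia))) /vtx_inj[]; lia.
Qed.

Lemma tB_gt i j : (i < n)%N -> (j < n)%N -> (s i < j)%N -> t (B i j) = A i j.-1.
Proof.
move=> li lj hj; have [ls h] := exitP li.
have [|||] := @A_covered i j.-1 => //; try lia.
  by move/eqP; rewrite -/(goR _ _) h; lia.
by rewrite prednK //; lia.
Qed.

Lemma tB_fix i j : (i < n)%N -> (j < n)%N -> t (B i j) = B i j -> j = s i.
Proof.
move=> li lj e; case: (ltngtP j (s i)) => // h.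
- by move: (tB_lt li lj h); rewrite e => /vtx_inj[].
- by move: (tB_gt li lj h); rewrite e => /vtx_inj[] //; lia.
Qed.

Lemma tlink_le r c : (0 < r < n)%N -> (c < n)%N -> (r <= k c)%N ->
  t (link n r c) = B r.-1 c.
Proof.
move=> hr hc hk; have [lk h] := entryP hc.
have := h r.-1; rewrite /goU prednK; last by lia.
have ln : (r <= n)%N by lia.
by rewrite hk => /(_ ln) /andP[_ /eqP].
Qed.

Lemma tlink_gt r c : (0 < r < n)%N -> (c < n)%N -> (k c < r)%N ->
  t (link n r c) = B r c.
Proof.
move=> hr hc hk; have [lk h] := entryP hc.
case: (tlink hr hc) => // /eqP e.
have := h r.-1; rewrite /goU prednK; last by lia.
by rewrite e; lia.
Qed.

Lemma entry_exit i : (i < n)%N -> k (s i) = i.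
Proof.
move=> li; have [ls _] := exitP li; have [lk h] := entryP ls.
have e := tB_eq li; apply/eqP; case: ltngtP => // hk.
  have hr : (0 < i < n)%N by lia.
  have e' : t (link n i (s i)) = B i (s i) by apply: tlink_gt.
  by case: (link_neq (esym (t_inj (BN li ls) (link_lt hr ls) (etrans e (esym e'))))).
have hr : (0 < i.+1 < n)%N by lia.
have e' : t (link n i.+1 (s i)) = B i (s i) by apply: tlink_le.
by case: (link_neq (esym (t_inj (BN li ls) (link_lt hr ls) (etrans e (esym e'))))).
Qed.

Lemma exit_entry c : (c < n)%N -> s (k c) = c.
Proof.
move=> lc; have [lk _] := entryP lc; apply/esym/tB_fix => //.
case: (B_covered lk lc) => // -[h0].
  rewrite tlink_le //; last by lia.
  by case/vtx_inj=> //; lia.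
by rewrite tlink_gt //; case/vtx_inj=> //; lia.
Qed.

Lemma support_flow : exists s k : nat -> nat,
  [/\ forall i, (i < n)%N -> (s i < n)%N,
      forall j, (j < n)%N -> (k j < n)%N,
      forall i, (i < n)%N -> k (s i) = i,
      forall j, (j < n)%N -> s (k j) = j
    & forall v, (v < N)%N -> t v = flow n s k v].
Proof.
exists s, k; split=> [i /exitP[]//|j /entryP[]//|i /entry_exit//|j /exit_entry//|v].
case/vtxP=> i j b li lj ->.
case: flowP => //; try (by move=> i' /exitP[]).
- by move=> h _; apply: tB_lt.
- by move=> ->; apply: tB_eq.
- by move=> h; apply: tB_gt.
- move=> h; have := t_supp (vtx_lt true li lj).
  by rewrite kind_vtx // /kind_at h eqxx; case: eqP.
- by move=> h1 h2 h3; rewrite vtx_link // h1 tlink_le //; lia.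
- by move=> h1 h2 h3; rewrite vtx_link // h1 tlink_gt //; lia.
- by move=> h1 h2; rewrite vtx_link ?ifF ?tlink_le //; lia.
- by move=> h1 h2; rewrite vtx_link ?ifF ?tlink_gt //; lia.
Qed.
End Converse.

Definition natperm n (s : 'S_n) (i : nat) : nat :=
  oapp (fun o : 'I_n => val (s o)) i (insub i).

Lemma natpermE n (s : 'S_n) (i : 'I_n) : natperm s i = s i.
Proof. by rewrite /natperm valK. Qed.

Lemma natperm_lt n (s : 'S_n) i : (i < n)%N -> (natperm s i < n)%N.
Proof. by move=> li; rewrite -[i]/(val (Ordinal li)) natpermE. Qed.

Lemma natpermK n (s : 'S_n) i : (i < n)%N -> natperm s^-1 (natperm s i) = i.
Proof. by move=> li; rewrite -[i]/(val (Ordinal li)) !natpermE permK. Qed.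

Lemma natpermKV n (s : 'S_n) i : (i < n)%N -> natperm s (natperm s^-1 i) = i.
Proof. by move=> li; rewrite -[i]/(val (Ordinal li)) !natpermE permKV. Qed.

Section FlowPerm.
Variables (n : nat).
Implicit Types (s : 'S_n).

Definition flow_ord s (v : 'I_(grid_size n)) : 'I_(grid_size n) :=
  insubd v (flow n (natperm s) (natperm s^-1) v).

Lemma flow_ordE s v : flow_ord s v = flow n (natperm s) (natperm s^-1) v :> nat.
Proof.
rewrite /flow_ord val_insubd ifT //; apply: flow_lt => // i.
exact: natperm_lt.
Qed.

Lemma flow_ord_inj s : injective (flow_ord s).
Proof.
move=> u v /(congr1 val); rewrite /= !flow_ordE => e; apply: val_inj.
apply: flow_inj e => // i;
  [exact: natperm_lt|exact: natperm_lt|exact: natpermK|exact: natpermKV].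
Qed.

Definition flow_perm s : 'S_(grid_size n) := perm (@flow_ord_inj s).

Lemma flow_permE s v :
  flow_perm s v = flow n (natperm s) (natperm s^-1) v :> nat.
Proof. by rewrite permE flow_ordE. Qed.

Definition ivtx (i j : 'I_n) (b : bool) : 'I_(grid_size n) :=
  Ordinal (vtx_lt b (ltn_ord i) (ltn_ord j)).

Lemma flow_permP s (i j : 'I_n) b :
  flow_spec n (natperm s) (natperm s^-1) i j b (flow_perm s (ivtx i j b))
    (kind_of n (vtx n i j b) (flow_perm s (ivtx i j b))).
Proof. by rewrite flow_permE; apply: flowP => // i'; exact: natperm_lt. Qed.

Lemma ivtxP (v : 'I_(grid_size n)) : exists i j b, v = ivtx i j b.
Proof.
case/vtxP: (ltn_ord v) => i j b li lj e.
by exists (Ordinal li), (Ordinal lj), b; apply: val_inj.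
Qed.

Lemma flow_perm_supp s (v : 'I_(grid_size n)) : kind_of n v (flow_perm s v) <> KZero.
Proof. by have [i [j [b ->]]] := ivtxP v; case: flow_permP. Qed.

Lemma flow_perm_fix s (i j : 'I_n) :
  (flow_perm s (ivtx i j false) == ivtx i j false) = (j == s i).
Proof.
rewrite -!val_eqE /= flow_permE flow_vtx // /flow_at natpermE /vtx.
by case: ltngtP => h; lia.
Qed.

Lemma flow_perm_inj : injective flow_perm.
Proof.
move=> s s' e; apply/permP => i; apply/eqP.
by rewrite -flow_perm_fix -e flow_perm_fix.
Qed.

Lemma support_flow_perm (t : 'S_(grid_size n)) :
  (forall v : 'I_(grid_size n), kind_of n v (t v) <> KZero) -> exists s, t = flow_perm s.
Proof.
move=> supp; case: (posnP n) => [n0|n0].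
  have N0 : grid_size n = 0%N by rewrite n0.
  by exists 1%g; apply/permP => v; have := ltn_ord v; lia.
have [|||f [g [f_lt g_lt fK gK tE]]] := @support_flow n (natperm t) n0.
- move=> u v lu lv; rewrite -[u]/(val (Ordinal lu)) -[v]/(val (Ordinal lv)).
  by rewrite !natpermE => /val_inj/perm_inj ->.
- move=> u lu; exists (natperm t^-1 u); first exact: natperm_lt.
  exact: natpermKV.
- move=> v lv; rewrite -[v]/(val (Ordinal lv)) natpermE; exact: supp.
have f_inj : injective (fun i : 'I_n => Ordinal (f_lt i (ltn_ord i))).
  move=> i j /(congr1 (g \o val)) /=; rewrite !fK // => e.
  exact: val_inj.
pose s := perm f_inj.
have sf i : (i < n)%N -> natperm s i = f i.
  by move=> li; rewrite -[i]/(val (Ordinal li)) natpermE permE.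
have sg i : (i < n)%N -> natperm s^-1 i = g i.
  move=> li; rewrite -[g i](natpermK s) ?sf ?gK //; exact: g_lt.
exists s; apply/permP => v; apply: val_inj => /=.
rewrite flow_permE -natpermE tE //.
have [i [j [b ->]]] := ivtxP v; rewrite /= !flow_vtx // /flow_at sf //.
case: b => //; case: eqP => // ne; case: ifP => _; rewrite sg //.
by have := ltn_ord j; lia.
Qed.
End FlowPerm.

Section Weights.
Variables (R : pzRingType) (c : bool).

Definition entry (w : R) (x : kind) : R :=
  match x with KZero => 0 | KOne => 1 | KNeg => (-1) ^+ c | KWeight => w end.

Definition cell n (G : 'M[R]_n) (a : nat) : R :=
  \sum_(i < n) \sum_(j < n | a == (i * n + j)%N) G i j.

Lemma cellE n (G : 'M[R]_n) (i j : 'I_n) : cell G (i * n + j) = G i j.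
Proof.
rewrite /cell (bigD1 i) //= [X in _ + X]big1 ?addr0 => [|i' ne].
  rewrite (bigD1 j) //= big1 ?addr0 // => j' /andP[/eqP e] /eqP[].
  by apply: val_inj => /=; lia.
rewrite big1 // => j' /eqP e; case/eqP: ne; apply: val_inj => /=.
have := congr1 (divn^~ n) e; rewrite !divnMDl ?divn_small ?addn0 //.
all: by have := ltn_ord j; lia.
Qed.

Definition grid_mx n (G : 'M[R]_n) : 'M[R]_(grid_size n) :=
  \matrix_(v, u) entry (cell G v./2) (kind_of n v u).

Lemma prod_eq0 (I : eqType) (r : seq I) (F : I -> R) i :
  i \in r -> F i = 0 -> \prod_(i <- r) F i = 0.
Proof.
move=> ir F0; elim: r ir => // a r IH; rewrite inE big_cons.
by case: eqP => [<- _|_ /= /IH ->]; rewrite ?F0 ?mul0r ?mulr0.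
Qed.

Lemma sum_grid_mx n (G : 'M[R]_n) (x : 'S_(grid_size n) -> R) :
  \sum_t x t * \prod_v grid_mx G v (t v) =
  \sum_s x (flow_perm s) * \prod_v grid_mx G v (flow_perm s v).
Proof.
pose P (t : 'S_(grid_size n)) := [exists s, t == flow_perm s].
rewrite (bigID P) /= [X in _ + X]big1 ?addr0 => [|t nP]; last first.
  have [v hv] : exists v : 'I_(grid_size n), kind_of n v (t v) = KZero.
    pose Z (v : 'I_(grid_size n)) := if kind_of n v (t v) is KZero then true else false.
    have [/existsP[v Zv]|] := boolP [exists v, Z v].
      by exists v; move: Zv; rewrite /Z; case: kind_of.
    rewrite negb_exists => /forallP h; case/existsP: nP.
    have [|s ->] := @support_flow_perm n t; last by exists s.
    by move=> v e; have := h v; rewrite /Z e.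
  by rewrite (prod_eq0 (mem_index_enum v)) ?mulr0 // mxE hv.
pose inv (t : 'S_(grid_size n)) := odflt 1%g [pick s | t == flow_perm s].
have invK s : inv (flow_perm s) = s.
  rewrite /inv; case: pickP => [s' /eqP/flow_perm_inj ->//|/(_ s)].
  by rewrite eqxx.
rewrite (reindex_onto (@flow_perm n) inv) => [|t /existsP[s /eqP ->]]; last by rewrite invK.
apply: eq_bigl => s; rewrite invK eqxx andbT; apply/existsP; by exists s.
Qed.
End Weights.

Lemma big_vtx (R : Type) (idx : R) (op : Monoid.law idx) n (f : nat -> R) :
  \big[op/idx]_(v < grid_size n) f v =
  \big[op/idx]_(i < n) \big[op/idx]_(j < n)
    op (f (vtx n i j false)) (f (vtx n i j true)).
Proof.
rewrite -(big_mkord xpredT f) -muln2 big_nat_mul big_nat_mul big_mkord.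
apply: eq_bigr => i _; rewrite -[X in \big[_/_]_(X <= _ < _) _]add0n big_addn.
rewrite mulSn addnK big_mkord.
apply: eq_bigr => j _; rewrite mulSn addnC muln2 addnC.
by rewrite big_ltn ?big_nat1 1?addnC /vtx ?addn0 ?addn1 1?addnC.
Qed.

Definition is_neg (x : kind) := if x is KNeg then true else false.

Lemma prod_signed (R : pzRingType) I (r : seq I) (b : I -> bool) (g : I -> R) :
  \prod_(i <- r) ((-1) ^+ b i * g i) =
  (-1) ^+ (\big[addb/false]_(i <- r) b i) * \prod_(i <- r) g i.
Proof.
elim: r => [|i r IH]; first by rewrite !big_nil expr0 mulr1.
rewrite !big_cons IH signr_addb !mulrA; congr (_ * _).
by rewrite -!mulrA; congr (_ * _); rewrite commr_sign.
Qed.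

Definition flow_sign n (s : 'S_n) : bool :=
  \big[addb/false]_(v < grid_size n) is_neg (kind_of n v (flow_perm s v)).

Section Product.
Variables (R : pzRingType) (c : bool) (n : nat) (G : 'M[R]_n).

Lemma prod_grid_mx (s : 'S_n) :
  \prod_v grid_mx c G v (flow_perm s v) =
  (-1) ^+ (c && flow_sign s) * \prod_(i < n) G i (s i).
Proof.
pose g v := if kind_of n v (flow n (natperm s) (natperm s^-1) v) is KWeight
            then cell G v./2 else 1.
transitivity (\prod_(v < grid_size n)
  ((-1) ^+ (c && is_neg (kind_of n v (flow_perm s v))) * g v)).
  apply: eq_bigr => v _; have := @flow_perm_supp n s v.
  rewrite mxE /g -flow_permE.
  by case: kind_of => //=; rewrite ?andbF ?andbT ?mul1r ?mulr1.
rewrite prod_signed; congr (_ * _).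
  congr (_ ^+ nat_of_bool _); rewrite /flow_sign; case: c => //=.
  by rewrite big1.
rewrite big_vtx; apply: eq_bigr => i _.
transitivity (\prod_(j < n | j == s i) G i j); last by rewrite big_pred1_eq.
rewrite [RHS]big_mkcond; apply: eq_bigr => j _.
have F b := @flowP n _ (natperm s^-1) (@natperm_lt n s) i j b (ltn_ord i) (ltn_ord j).
have gE b : g (vtx n i j b) = if ~~ b && (j == s i) then G i j else 1.
  rewrite -val_eqE /= -natpermE /g vtx_half cellE.
  by case: (F b) => //= *; case: eqP => //; lia.
by rewrite [LHS]/= !gE /= mulr1.
Qed.
End Product.

Lemma sum_delta (R : nmodType) N w (x : R) : (w < N)%N \/ x = 0 ->
  \sum_(v < N) (if v == w :> nat then x else 0) = x.
Proof.
case=> [lw|->]; last by rewrite big1 // => v _; case: ifP.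
rewrite -big_mkcond /= (bigD1 (Ordinal lw)) //= big1 ?addr0 // => v.
by case/andP=> /eqP e /eqP []; apply: val_inj.
Qed.

Lemma vtx_eq n i j b i' j' b' : (j < n)%N -> (j' < n)%N ->
  (vtx n i j b == vtx n i' j' b') = [&& i == i', j == j' & b == b'].
Proof.
move=> lj lj'; apply/eqP/and3P => [/(vtx_inj lj lj')[-> -> ->]//|].
by case=> /eqP -> /eqP -> /eqP ->.
Qed.

Lemma link_if (R : nmodType) n r c r' c' (a : R) :
  (0 < r < n)%N -> (c < n)%N -> (c' < n)%N -> (~~ (0 < r' < n)%N -> a = 0) ->
  (if link n r c == link n r' c' then a else 0) =
  if (r == r') && (c == c') then a else 0.
Proof.
move=> hr hc hc' a0; case: (boolP (0 < r' < n)%N) => [hr'|/a0 ->].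
  by rewrite link_eq.
by rewrite !if_same.
Qed.

Lemma dummy_if (R : nmodType) n i r' c' (a : R) : (i < n)%N -> (c' < n)%N ->
  (~~ (0 < r' < n)%N -> a = 0) ->
  (if vtx n i n.-1 true == link n r' c' then a else 0) = 0.
Proof.
move=> li hc' a0; case: (boolP (0 < r' < n)%N) => [hr'|/a0 ->]; last by rewrite if_same.
by rewrite /link; case: (leqP r' c') => h; rewrite vtx_eq ?ifF //; lia.
Qed.

(** * The sign of a cycle cover *)

Section Kernel.
Variables (n : nat) (G : 'M[int]_n) (p q : 'I_n).
Hypothesis pq : (p < q)%N.
Hypothesis rows_eq : forall j, G p j = G q j.

Let g (j : nat) : int := cell G (p * n + j).

(* Adding up the cells of a row eliminates its row links; the difference of two
   equal rows of [G] is then a combination of column links. *)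
Definition kernel_at (i j : nat) (b : bool) : int :=
  if b then
    if j.+1 == n then 0
    else if (i <= j)%N then - g j.+1 * ((p <= i < q)%N%:R)
    else - g j * (p < i <= q)%N%:R
  else (i == p :> nat)%:R - (i == q :> nat)%:R.

Definition kernel (v : nat) : int :=
  kernel_at (v./2 %/ n) (v./2 %% n) (odd v).

Lemma kernel_vtx i j b : (j < n)%N -> kernel (vtx n i j b) = kernel_at i j b.
Proof. by move=> jn; rewrite /kernel vtx_row // vtx_col // vtx_odd. Qed.

Lemma kernel_link r c : (0 < r < n)%N -> (c < n)%N ->
  kernel (link n r c) = - g c * (p < r <= q)%N%:R.
Proof.
move=> hr hc; rewrite /link; case: (leqP r c) => h; rewrite kernel_vtx; try lia.
all: rewrite /kernel_at ifF; last by lia.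
  rewrite ifT; last by lia.
  by rewrite prednK; [congr (_ * _%:R); lia|lia].
by rewrite ifF //; lia.
Qed.

Lemma det_grid_mx_eq_rows : \det (grid_mx true G) = 0.
Proof.
have n0 : (0 < n)%N by case: (n) p => [[]|].
have dummy i : kernel (vtx n i n.-1 true) = 0.
  by rewrite kernel_vtx /kernel_at ?prednK ?eqxx //; lia.
apply/eqP/det0P; exists (\row_v kernel v).
  apply/eqP => /rowP/(_ (ivtx p p false)); rewrite !mxE /= kernel_vtx //=.
  by rewrite /kernel_at eqxx; case: eqP => //; lia.
apply/rowP => w; rewrite !mxE.
under eq_bigr do rewrite !mxE.
case: (gridP (ltn_ord w)) => [i j li lj|r c hr hc|i li].
- pose x := ((i == p :> nat)%:R - (i == q :> nat)%:R) * g j.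
  pose y := g j * (p < i <= q)%N%:R.
  pose z := - g j * (p <= i < q)%N%:R.
  have y0 : ~~ (0 < i < n)%N -> y = 0.
    move=> h; rewrite /y; have -> : (p < i <= q)%N = false by lia.
    by rewrite mulr0.
  have z0 : ~~ (0 < i.+1 < n)%N -> z = 0.
    move=> h; rewrite /z; have -> : (p <= i < q)%N = false by have := ltn_ord q; lia.
    by rewrite mulr0.
  transitivity (\sum_(v < grid_size n) ((if v == vtx n i j false :> nat then x else 0)
    + (if v == link n i j :> nat then y else 0)
    + (if v == link n i.+1 j :> nat then z else 0))).
    apply: eq_bigr => v _; case: (gridP (ltn_ord v)) => [i' j' li' lj'|r' c' hr' hc'|i' li'].
    + rewrite kernel_vtx // kind_vtx // /kind_at.
      rewrite ![_ == link _ _ _]eq_sym !link_eqF !addr0 [vtx n i' j' false == _]eq_sym.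
      case: eqP => [/(vtx_inj lj lj')[<- <- _]|_].
        rewrite /= vtx_half /x /kernel_at /g.
        case: (eqVneq i p) => [->|] //=.
        case: (eqVneq i q) => [->|] /=; last by rewrite subr0 !mul0r.
        by rewrite -[j]/(val (Ordinal lj)) !cellE rows_eq.
      rewrite !vtxBS [_ == vtx n i' j' false]vtx_eq //.
      by rewrite [_ == vtx n i' j' true]vtx_eq // !andbF mulr0.
    + rewrite kernel_link // kind_link // link_eqF add0r !link_if //.
      rewrite !vtx_eq // !andbT ![j == c']eq_sym.
      have -> : (i == r'.-1) = (r' == i.+1) by lia.
      rewrite [i == r']eq_sym; case: eqP => [->|_] /=.
        have -> : (i.+1 == i) = false by lia.
        by rewrite add0r; case: eqP => [->|_]; rewrite ?mulr1 ?mulr0.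
      case: eqP => [->|_] /=; rewrite ?mulr0 // addr0.
      by case: eqP => [->|_]; rewrite ?mulr0 //= expr1 mulrN1 mulNr opprK.
    + rewrite dummy mul0r !dummy_if // !addr0 ifF //.
      by apply/eqP => /(congr1 odd); rewrite !vtx_odd.
  rewrite !big_split /= !sum_delta.
  + have e : (i == p)%:R - (i == q)%:R + (p < i <= q)%N%:R = (p <= i < q)%N%:R :> int.
      by case: (ltngtP i p) => h; case: (ltngtP i q) => h' //=; lia.
    by rewrite /x /y /z mulNr -e; ring.
  + by case: (boolP (0 < i.+1 < n)%N) => h; [left; apply: link_lt|right; apply: z0].
  + by case: (boolP (0 < i < n)%N) => h; [left; apply: link_lt|right; apply: y0].
  + by left; apply: vtx_lt.
- have [i [j [li lj e]]] : exists i j,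
      [/\ (i < n)%N, (j.+1 < n)%N & link n r c = vtx n i j true].
    by rewrite /link; case: ifP => h; [exists r.-1, c.-1|exists r, c]; split=> //; lia.
  rewrite e; pose x : int := (i == p :> nat)%:R - (i == q :> nat)%:R.
  transitivity (\sum_(v < grid_size n) ((if v == vtx n i j false :> nat then x else 0)
    + (if v == vtx n i j.+1 false :> nat then - x else 0))); last first.
    by rewrite big_split /= !sum_delta ?subrr //; left; apply: vtx_lt; lia.
  have lj' : (j < n)%N by lia.
  apply: eq_bigr => v _; case: (gridP (ltn_ord v)) => [i' j' li' lj1|r' c' hr' hc'|i' li'].
  + rewrite kind_vtx // /kind_at kernel_vtx // /kernel_at vtxAS vtxBS.
    rewrite !vtx_eq // !andbF !andbT.
    rewrite ![i == i']eq_sym ![_ == j']eq_sym /x.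
    case: (eqVneq i' i) => [->|_] /=; last by rewrite mulr0 addr0.
    case: (eqVneq j' j.+1) => [->|_] /=.
      by have -> : (j.+1 == j) = false by [lia]; rewrite add0r mulrN1.
    by case: (eqVneq j' j) => [->|_]; rewrite ?lj ?mulr1 ?mulr0 addr0.
  + by rewrite kind_link // -e !link_eqF mulr0 addr0.
  + by rewrite dummy mul0r !vtx_eq ?andbF ?addr0 //; lia.
- rewrite big1 // => v _; case: (gridP (ltn_ord v)) => [i' j' li' lj'|r' c' hr' hc'|i' li'].
  + rewrite kind_vtx // /kind_at vtxAS vtxBS.
    have -> : vtx n i n.-1.+1 false = vtx n i.+1 0 false.
      by rewrite prednK // /vtx mulSn; lia.
    rewrite !vtx_eq ?prednK //= ?andbF ?andbT //.
    have -> : (i.+1 == i') && (0%N == j') && (0 < j')%N = false by lia.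
    have -> : (i == i') && (n.-1 == j') && (j'.+1 < n)%N = false by lia.
    by rewrite mulr0.
  + by rewrite kind_link // ![vtx n i _ true == _]vtx_eq ?andbF ?mulr0 //; lia.
  + by rewrite dummy mul0r.
Qed.
End Kernel.

Lemma odd_perm_involution N (s : 'S_N) : involutive s ->
  odd_perm s = \big[addb/false]_v (s v < v)%N.
Proof.
move: {2}(#|[pred v | s v < v]%N|) (leqnn #|[pred v | s v < v]%N|) => m.
elim: m s => [|m IH] s; rewrite ?leqn0 => le_m sK.
  have F v : (s v < v)%N = false.
    by have := card0_eq (eqP le_m) v; rewrite inE.
  rewrite big1 => [|v _]; last by rewrite F.
  suff -> : s = 1%g by rewrite odd_perm1.
  apply/permP => v; rewrite perm1; apply: val_inj => /=.
  by have := F v; have := F (s v); rewrite sK; lia.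
case: (pickP [pred v | s v < v]%N) => [w /= lw|F]; last first.
  apply: IH => //; rewrite (eq_card0 _) // => v; exact: F.
pose s' := (tperm w (s w) * s)%g.
have ne : w != s w by rewrite -val_eqE /=; lia.
have s'E v : s' v = if (v == w) || (v == s w) then v else s v.
  rewrite permM; case: tpermP => [->|->|/eqP/negbTE -> /eqP/negbTE -> //].
    by rewrite eqxx sK.
  by rewrite eqxx orbT.
have s'K : involutive s'.
  move=> v; rewrite [s' v]s'E; case: ifP => F; rewrite s'E ?F //.
  have -> : (s v == w) || (s v == s w) = false.
    apply: contraFF F => /orP[/eqP <-|/eqP/perm_inj ->]; rewrite ?sK eqxx ?orbT //.
  exact: sK.
have -> : odd_perm s = ~~ odd_perm s' by rewrite odd_mul_tperm ne addTb negbK.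
rewrite IH //; last first.
  rewrite -ltnS; apply: leq_trans le_m; apply: proper_card.
  apply/properP; split.
    apply/fintype.subsetP => v; rewrite !inE s'E; case: ifP => //; lia.
  by exists w; rewrite !inE // s'E eqxx /=; lia.
rewrite (bigD1 w) //= [RHS](bigD1 w) //= lw s'E eqxx ltnn /=.
congr (~~ _); apply: eq_bigr => v vw; rewrite s'E (negbTE vw) /=.
case: eqP => // ->; rewrite sK; lia.
Qed.

Section Sign.
Variable n : nat.
Implicit Types s : 'S_n.

Definition grid_sign s : bool := odd_perm (flow_perm s) (+) flow_sign s.

Lemma det_grid_mx_sum (R : pzRingType) (G : 'M[R]_n) :
  \det (grid_mx true G) = \sum_s (-1) ^+ (grid_sign s) * \prod_i G i (s i).
Proof.
rewrite /determinant (sum_grid_mx true G (fun t => (-1) ^+ t)).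
by apply: eq_bigr => s _; rewrite prod_grid_mx /= mulrA -signr_addb.
Qed.

Lemma grid_sign_tperm s (p q : 'I_n) : p != q ->
  grid_sign (tperm p q * s)%g = ~~ grid_sign s.
Proof.
wlog pq : p q / (p < q)%N.
  move=> W; case: (ltngtP p q) => [|h|/val_inj ->].
  - exact: W.
  - by rewrite eq_sym tpermC; apply: W.
  - by rewrite eqxx.
move=> ne; pose t := (tperm p q * s)%g.
pose G : 'M[int]_n := \matrix_(a, b)
  (if a \in [:: p; q] then b \in [:: s p; s q] else b == s a)%:R.
have := @det_grid_mx_eq_rows n G p q pq; rewrite det_grid_mx_sum => det0.
have {}det0 := det0 (ltac:(by move=> j; rewrite !mxE !inE !eqxx orbT)).
have tE a : t a = s (tperm p q a) by rewrite permM.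
have ts : t != s.
  by apply/eqP => /permP/(_ p); rewrite tE tpermL => /perm_inj/eqP; rewrite eq_sym (negbTE ne).
move: det0; rewrite (bigD1 s) //= (bigD1 t) //= [X in _ + (_ + X)]big1 => [|u /andP[us ut]].
  rewrite !big1 => [|a _|a _].
  - rewrite -/t !mulr1 addr0; case: (grid_sign t); case: (grid_sign s) => //=.
  - rewrite mxE tE !inE.
    by case: tpermP => [->|->|/eqP/negbTE -> /eqP/negbTE ->]; rewrite ?eqxx ?orbT.
  - by rewrite mxE !inE; case: ifP => [/orP[]/eqP ->|]; rewrite eqxx ?orbT.
suff [a /eqP Ga] : exists a, G a (u a) == 0.
  by rewrite (prod_eq0 (mem_index_enum a)) ?mulr0.
apply/existsP; apply: contraNT ut; rewrite negb_exists => /forallP h.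
have uE a : if a \in [:: p; q] then u a \in [:: s p; s q] else u a == s a.
  by have := h a; rewrite mxE; case: ifP => _; [case: (u a \in _)|case: (u a == _)].
have := uE p; have := uE q; rewrite !inE !eqxx orbT /=.
have uE' a : a != p -> a != q -> u a = s a.
  by move=> ap aq; have := uE a; rewrite !inE (negbTE ap) (negbTE aq) => /eqP.
case/orP=> /eqP uq /orP[] /eqP up.
- by have := perm_inj (etrans up (esym uq)) => /eqP; rewrite (negbTE ne).
- apply/eqP/permP => a; rewrite tE.
  by case: tpermP => [->|->|/eqP ap /eqP aq] //; apply: uE'.
- case/eqP: us; apply/permP => a.
  by have [->//|ap] := eqVneq a p; have [->//|aq] := eqVneq a q; apply: uE'.
- by have := perm_inj (etrans up (esym uq)) => /eqP; rewrite (negbTE ne).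
Qed.

Lemma grid_sign1 : grid_sign 1%g = false.
Proof.
have id1 i : (i < n)%N -> natperm (1%g : 'S_n) i = i.
  by move=> li; rewrite -[i]/(val (Ordinal li)) natpermE perm1.
have flow1 (v : 'I_(grid_size n)) : flow_perm 1%g v = flow n id id v :> nat.
  rewrite flow_permE invg1; have [i [j [b ->]]] := ivtxP v.
  rewrite /= !flow_vtx // /flow_at; case: b; last by rewrite id1.
  case: eqP => //= ne; rewrite !id1 //.
  by have := ltn_ord j; lia.
have flowP1 i j b (li : (i < n)%N) (lj : (j < n)%N) :=
  @flowP n id id (fun i li => li) i j b li lj.
rewrite /grid_sign odd_perm_involution.
  rewrite /flow_sign -big_split /= big1 // => v _; rewrite flow1.
  have [i [j [b ->]]] := ivtxP v => /=.
  case: flowP1 => //= *; rewrite /vtx ?mulSn; lia.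
move=> v; apply: val_inj => /=; rewrite !flow1.
have [i [j [b ->]]] := ivtxP v => /=.
case: flowP1 => //= *; rewrite ?flow_vtx // /flow_at; try lia.
all: have lj := ltn_ord j; rewrite /vtx; do ?[case: ifP]; lia.
Qed.

Lemma grid_signE s : grid_sign s = odd_perm s.
Proof.
have [ts -> /allP] := prod_tpermP s.
elim: ts => [|t ts IH] h; first by rewrite big_nil grid_sign1 odd_perm1.
have ht : t.1 != t.2 := h t (mem_head _ _).
rewrite big_cons grid_sign_tperm // IH ?odd_mul_tperm; last first.
  by move=> u hu; apply: h; rewrite inE hu orbT.
by rewrite ht.
Qed.

Lemma det_grid_mx (R : pzRingType) (G : 'M[R]_n) :
  \det (grid_mx true G) = \det G.
Proof.
by rewrite det_grid_mx_sum; apply: eq_bigr => s _; rewrite grid_signE.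
Qed.

Lemma perm_grid_mx (R : pzRingType) (G : 'M[R]_n) :
  \sum_(t : 'S_(grid_size n)) \prod_v grid_mx false G v (t v) =
  \sum_(s : 'S_n) \prod_i G i (s i).
Proof.
have := sum_grid_mx false G (fun=> 1).
under eq_bigr do rewrite mul1r; move=> ->.
by apply: eq_bigr => s _; rewrite prod_grid_mx !mul1r.
Qed.
End Sign.

(** * Planarity *)

Lemma intr_addl_neq (a b : int) (t : RR) : 0 < t < 1 -> a%:~R + t <> b%:~R.
Proof.
case/andP=> t0 t1 e.
have h1 : a%:~R < b%:~R :> RR by rewrite -e ltrDl.
have h2 : b%:~R < (a + 1)%:~R :> RR by rewrite -e intrD ltrD2l.
by move: h1 h2; rewrite !ltr_int; lia.
Qed.

Lemma intr_addl_inj (a b : int) (s t : RR) : 0 < s < 1 -> 0 < t < 1 ->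
  a%:~R + s = b%:~R + t -> a = b.
Proof.
move=> /andP[s0 s1] /andP[t0 t1] e.
have h1 : a%:~R < (b + 1)%:~R :> RR by rewrite intrD; lra.
have h2 : b%:~R < (a + 1)%:~R :> RR by rewrite intrD; lra.
by move: h1 h2; rewrite !ltr_int; lia.
Qed.

Lemma affine_continuous (R : realType) (a b : R) : continuous (fun t : R => a + t * b).
Proof.
move=> t; apply: cvgD; first exact: cvg_cst.
by apply: cvgM; [exact: cvg_id|exact: cvg_cst].
Qed.

Section GridDrawing.
Variables (n : nat) (e : rel 'I_n) (X Y : 'I_n -> int).
Hypothesis XY_inj : forall i j, X i = X j -> Y i = Y j -> i = j.
Hypothesis unit_step : forall i j : 'I_n, (i < j)%N -> e i j ->
  (X j = X i + 1 /\ Y j = Y i) \/ (X j = X i /\ Y j = Y i + 1).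

Let pos i : plane := ((X i)%:~R, (Y i)%:~R).
Let arc i j (t : RR) : plane :=
  ((X i)%:~R + t * (X j - X i)%:~R, (Y i)%:~R + t * (Y j - Y i)%:~R).

Lemma arcP (i j : 'I_n) : (i < j)%N -> e i j ->
  [/\ X j = X i + 1, Y j = Y i & forall t, arc i j t = ((X i)%:~R + t, (Y i)%:~R)] \/
  [/\ X j = X i, Y j = Y i + 1 & forall t, arc i j t = ((X i)%:~R, (Y i)%:~R + t)].
Proof.
move=> lij /(unit_step lij)[] [ex ey]; [left|right]; split=> // t; rewrite /arc ex ey.
  by rewrite subrr mulr0 addr0 addrAC subrr add0r mulr1.
by rewrite subrr mulr0 addr0 [Y i + 1 - _]addrAC subrr add0r mulr1.
Qed.

Lemma arc_continuous i j : continuous (arc i j).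
Proof.
move=> t; exact: (cvg_pair (@affine_continuous RR _ _ t) (@affine_continuous RR _ _ t)).
Qed.

Lemma planar_graph_unit_steps : planar_graph e.
Proof.
exists pos, arc; split.
- by move=> i j [] /intr_inj ex /intr_inj ey; apply: XY_inj.
- move=> i j lij eij; split.
  + by apply: continuous_subspaceT => t; exact: arc_continuous.
  + move=> s t _ _; case: (arcP lij eij) => -[_ _ E]; rewrite !E => -[]; exact: addrI.
  + by rewrite /arc !mul0r !addr0.
  + by rewrite /arc !mul1r -!intrD !subrKC.
- move=> i j k lij eij t t01; case: (arcP lij eij) => -[_ _ E]; rewrite E.
    by case=> /(intr_addl_neq t01).
  by case=> _ /(intr_addl_neq t01).
- move=> i j k l lij eij lkl ekl ne s t s01 t01.
  have [[ex ey E]|[ex ey E]] := arcP lij eij;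
  have [[fx fy F]|[fx fy F]] := arcP lkl ekl; rewrite E F => -[].
  + move=> /(intr_addl_inj s01 t01) h1 /intr_inj h2; apply: ne.
    by rewrite (XY_inj h1 h2); congr pair; apply: XY_inj; rewrite ?ex ?fx ?ey ?fy ?h1 ?h2.
  + by move=> /(intr_addl_neq s01).
  + by move=> /esym/(intr_addl_neq t01).
  + move=> /intr_inj h1 /(intr_addl_inj s01 t01) h2; apply: ne.
    by rewrite (XY_inj h1 h2); congr pair; apply: XY_inj; rewrite ?ex ?fx ?ey ?fy ?h1 ?h2.
Qed.
End GridDrawing.

(* Every edge joins a vertex to the next one in its row, or to the one below the
   latter; shearing the drawing makes the second kind of edge vertical. *)
Definition skew (n v : nat) : int :=
  (((v./2 %% n).*2 + odd v)%N%:Z - (v./2 %/ n)%N%:Z)%R.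

Lemma skew_vtx n i j b : (j < n)%N -> skew n (vtx n i j b) = (j.*2 + b)%N%:Z - i%:Z.
Proof. by move=> lj; rewrite /skew vtx_row // vtx_col // vtx_odd. Qed.

Definition grid_step n u v :=
  (skew n v = skew n u + 1 /\ (v./2 %/ n)%N%:Z = (u./2 %/ n)%N%:Z) \/
  (skew n v = skew n u /\ (v./2 %/ n)%N%:Z = (u./2 %/ n)%N%:Z + 1).

Lemma kind_step n u v : (u < grid_size n)%N -> kind_of n u v <> KZero ->
  ((u < v)%N -> grid_step n u v) /\ ((v < u)%N -> grid_step n v u).
Proof.
case/vtxP=> i j b li lj ->; rewrite kind_vtx // /kind_at /grid_step.
case: b.
  case: (eqVneq j.+1 n) => [_|ne]; first by case: eqP => // -> _; split; lia.
  case: (leqP i j) => ij.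
    case: eqP => [->|_].
      by rewrite vtxAS !skew_vtx ?vtx_row; try lia; split; [left|rewrite -vtxAS]; lia.
    case: eqP => // -> _.
    by rewrite vtxAD !skew_vtx ?vtx_row; try lia; split; [right|rewrite -vtxAD]; lia.
  rewrite -{1}vtxBS eqSS; case: eqP => [->|_].
    by rewrite -vtxBS; split; [lia|]; rewrite vtxBS !skew_vtx ?vtx_row //; left; lia.
  case: i ij li => // i ij li.
  rewrite -vtxBD eqn_add2r; case: eqP => // -> _; split; first lia.
  by rewrite vtxBD !skew_vtx ?vtx_row //; right; lia.
case: eqP => [-> _|_]; first by split; lia.
case: andP => [[/eqP e j0] _|_].
  have -> : v = vtx n i j.-1 true by apply: succn_inj; rewrite e vtxAS prednK.
  split; first by rewrite -{1}(prednK j0) -vtxAS; lia.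
  by rewrite !skew_vtx ?vtx_row //; try lia; left; lia.
case: andP => // -[/eqP -> _] _; split; last lia.
by rewrite vtxBS !skew_vtx ?vtx_row //; left; lia.
Qed.

Lemma planar_grid_mx (R : pzRingType) c n (G : 'M[R]_n) :
  planar_wdigraph (grid_mx c G).
Proof.
pose X (v : 'I_(grid_size n)) := skew n v.
pose Y (v : 'I_(grid_size n)) : int := (v./2 %/ n)%N%:Z.
apply: (@planar_graph_unit_steps _ _ X Y).
  move=> u v; have [i [j [b ->]]] := ivtxP u; have [i' [j' [b' ->]]] := ivtxP v.
  rewrite /X /Y /= !skew_vtx // !vtx_row // => h1 h2.
  apply: val_inj => /=; have -> : i = i' :> nat by lia.
  have -> : j = j' :> nat by case: b b' h1 => [] []; lia.
  by have -> : b = b' by case: b b' h1 => [] []; lia.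
have entry_neq0 u v : grid_mx c G u v != 0 -> kind_of n u v <> KZero.
  by rewrite mxE => + h; rewrite h eqxx.
move=> u v uv /orP[] /entry_neq0 /kind_step [] // h h'; [exact: h|exact: h'].
Qed.

(** * The program *)

(* Only meaningful for programs without loops. *)
Fixpoint run R (p : prog) (s : state R) : state R :=
  match p with
  | Do i => effect i s
  | Seq p q => run q (run p s)
  | If b p q => if holds b s then run p s else run q s
  | Skip | While _ _ => s
  end.

Fixpoint unit_cost (p : prog) : bool :=
  match p with
  | Do (AAdd _ _ _) | Do (AMul _ _ _) | While _ _ => false
  | Seq p q | If _ p q => unit_cost p && unit_cost q
  | _ => true
  end.

Fixpoint psize (p : prog) : nat :=
  match p with
  | Skip => 0
  | Do _ => 1
  | Seq p q => psize p + psize q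
  | If _ p q => (psize p + psize q).+1
  | While _ p => (psize p).+1
  end.

Lemma exec_run R p (s : state R) : unit_cost p ->
  exists2 t, exec p s t (run p s) & (t <= psize p)%N.
Proof.
elim: p s => [|i|p IHp q IHq|b p IHp q IHq|b p IHp] s //=.
- by exists 0; [constructor|].
- by move=> H; exists (cost i s); [exact: ExecDo|case: i H].
- case/andP=> /(IHp s)[t e le] /(IHq (run p s))[t' e' le'].
  by exists (t + t')%N; [apply: ExecSeq e e'|lia].
- case/andP=> /(IHp s)[t e le] /(IHq s)[t' e' le'].
  case: ifP => h; [exists t.+1|exists t'.+1]; try lia.
    exact: ExecIfT.
  by apply: ExecIfF; rewrite ?h.
Qed.

Lemma exec_while R b p (I : nat -> state R -> Prop) m :
  unit_cost p ->
  (forall k s, (k < m)%N -> I k s -> holds b s /\ I k.+1 (run p s)) ->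
  (forall s, I m s -> ~~ holds b s) ->
  forall s, I 0%N s -> exists t s',
    [/\ exec (While b p) s t s', (t <= m * (psize p).+1 + 1)%N & I m s'].
Proof.
move=> up step stop.
suff H d k s : (d + k = m)%N -> I k s -> exists t s',
    [/\ exec (While b p) s t s', (t <= d * (psize p).+1 + 1)%N & I m s'].
  by move=> s; apply: H; rewrite addn0.
elim: d k s => [|d IH] k s e Ik.
  have ek : k = m by lia.
  exists 1%N, s; rewrite -ek; split=> //.
  by apply: ExecWhileF; apply: stop; rewrite -ek.
have [||hb Ik1] := step k s; [lia|by []|].
have [t ex le] := exec_run s up.
have [||t' [s' [ex' le' Im]]] := IH k.+1 (run p s); [lia|by []|].
exists (t + t').+1, s'; split=> //; last by rewrite mulSn; lia.
exact: ExecWhileT ex ex'.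
Qed.

Lemma polynomial_bound d C : exists k, forall n, (C * n ^ d + C <= n ^ k + k)%N.
Proof.
exists (d + C.*2).+1 => -[|[|n]].
- by case: d => [|d]; rewrite ?expn0 !exp0n //; lia.
- by rewrite !exp1n; lia.
- have : (C * n.+2 ^ d <= n.+2 ^ (d + C.*2).+1)%N.
    rewrite -addnS expnD mulnC leq_mul2l; apply/orP; right.
    apply: leq_trans (ltnW (ltn_expl C (isT : 1 < n.+2)%N)) _.
    by rewrite leq_exp2l //; lia.
  by lia.
Qed.

Fixpoint seqs (ps : seq prog) : prog :=
  if ps is p :: ps' then Seq p (seqs ps') else Skip.

(* Counters, where N is the number of vertices of the output, and k = i * n + j
   is the number of the current cell (i, j):
     1: base address of the output        9: N + 1
     2: the constant 1                    10: scratch address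
     3: n                                 11, 12: addresses of the cells with
     4: i + 1                                 the values of [KNeg] and [KOne]
     5: j + 1                             13: 2n + 1
     6: k                                 14: the constant 2
     7: address of the current diagonal   15: n * n
        entry of the output               16: k + 1
     8: N
   The entries of the output that are not written are 0 from the start. *)
Definition square_loop : prog :=
  While (TLeq 4 3) (seqs [:: Do (IAdd 6 6 3); Do (IAdd 4 4 2)]).

Definition row_body : prog := seqs
  [:: Do (ACopy 7 6);
      If (TLeq 14 5) (seqs [:: Do (ISub 10 7 2); Do (ACopy 10 11)]) Skip;
      If (TLeq 3 5)
        (seqs [:: Do (IAdd 7 7 9); Do (ACopy 7 12); Do (IConst 5 1); Do (IAdd 4 4 2)])
        (seqs [:: Do (IAdd 10 7 2); Do (ACopy 10 12); Do (IAdd 7 7 9);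
          If (TLeq 4 5)
            (seqs [:: Do (IAdd 10 7 2); Do (ACopy 10 12);
                      Do (IAdd 10 7 13); Do (ACopy 10 11)])
            (seqs [:: Do (ISub 10 7 2); Do (ACopy 10 11);
                      Do (ISub 10 7 13); Do (ACopy 10 12)]);
          Do (IAdd 5 5 2)]);
      Do (IAdd 7 7 9); Do (IAdd 6 6 2); Do (IAdd 16 16 2)].

Definition row_loop : prog := While (TLeq 16 15) row_body.

Definition init_square : prog :=
  seqs [:: Do (IConst 2 1); Do (IConst 5 0); Do (IAdd 3 0 5); Do (IConst 4 1); Do (IConst 6 0)].

Definition init_rows (c : bool) : prog :=
  seqs [:: Do (IAdd 8 6 6); Do (IAdd 12 6 5); Do (IAdd 11 12 2); Do (IAdd 1 11 2);
    Do (AConst 12 true); Do (AConst 11 true);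
    (if c then Do (AOpp 11 11) else Skip);
    Do (IAdd 7 1 5); Do (IAdd 9 8 2); Do (IAdd 13 3 3); Do (IAdd 13 13 2);
    Do (IAdd 15 6 5); Do (IConst 16 1); Do (IConst 6 0); Do (IConst 4 1);
    Do (IConst 5 1); Do (IConst 14 2)].

Definition reduction (c : bool) : prog :=
  seqs [:: init_square; square_loop; init_rows c; row_loop;
           Do (IConst 5 0); Do (IAdd 0 8 5)].

Section Reduction.
Variables (R : pzRingType) (c : bool) (n : nat) (G : wdigraph R n).

Lemma cell_large a : (n * n <= a)%N -> cell G a = 0.
Proof.
move=> la; rewrite /cell big1 // => i _; rewrite big1 // => j /eqP e.
have := vtx_lt false (ltn_ord i) (ltn_ord j); rewrite /vtx; lia.
Qed.

Definition square_inv k (s : state R) : Prop :=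
  [/\ [/\ cnt s 2 = 1, cnt s 3 = n & cnt s 5 = 0]%N, 
      cnt s 4 = k.+1, cnt s 6 = (k * n)%N & aval s = cell G].

Lemma square_loopP s : square_inv 0 s -> exists t s',
  [/\ exec square_loop s t s', (t <= n * 3 + 1)%N & square_inv n s'].
Proof.
apply: exec_while => // [k {}s lk [[e2 e3 e5] e4 e6 ea]|{}s [[e2 e3 e5] e4 e6 ea]].
  split; first by rewrite /= e4 e3.
  by rewrite /square_inv /= e2 e3 e4 e5 e6 mulSn; split=> //; lia.
by rewrite /= e4 e3 ltnn.
Qed.

Let N := grid_size n.
Let base := (n * n + 2)%N.

Definition gentry v u : R := entry c (cell G v./2) (kind_of n v u).

Definition low (a : nat) : R :=
  if (a < n * n)%N then cell G a else if a == (n * n)%N then 1 else (-1) ^+ c.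

Definition const_regs (s : state R) : Prop :=
  [/\ cnt s 1 = base, cnt s 2 = 1%N, cnt s 3 = n, cnt s 8 = N & cnt s 9 = N.+1] /\
  [/\ cnt s 11 = (n * n).+1, cnt s 12 = (n * n)%N, cnt s 13 = n.*2.+1,
      cnt s 14 = 2%N & cnt s 15 = (n * n)%N].

(* [d] and the argument of [g] are offsets from the output address [base]. *)
Definition row_state x4 x5 x6 d x16 (g : nat -> R) (s : state R) : Prop :=
  [/\ const_regs s,
      [/\ cnt s 4 = x4, cnt s 5 = x5, cnt s 6 = x6, cnt s 7 = (base + d)%N
        & cnt s 16 = x16],
      forall a, (a < base)%N -> aval s a = low a
    & forall x, aval s (base + x) = g x].

Section RowState.
Variables (x4 x5 x6 d x16 : nat) (g : nat -> R) (s : state R).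
Hypothesis gs : row_state x4 x5 x6 d x16 g s.

Lemma row_state_write y v z : row_state x4 x5 x6 d x16
  [eta g with y |-> v] (set_alg s (base + y) v z).
Proof.
case: gs => cs rs lo hi; split=> // [a la|x] /=.
  by rewrite ifF ?lo //; lia.
by rewrite eqn_add2l hi.
Qed.

Lemma row_state_tmp y : row_state x4 x5 x6 d x16 g (set_cnt s 10 y).
Proof. by case: gs. Qed.
End RowState.

Section RowBlocks.
Variables (x4 x5 x6 d x16 : nat) (g : nat -> R) (s : state R).
Hypothesis gs : row_state x4 x5 x6 d x16 g s.
Let S d' g' := row_state x4 x5 x6 d' x16 g'.

Let lowE : [/\ low (n * n) = 1 & low (n * n).+1 = (-1) ^+ c].
Proof.
by rewrite /low !ltnn eqxx ltnNge leqnSn /= ifF //; lia.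
Qed.

Lemma run_weight : (x6 < n * n)%N ->
  S d [eta g with d |-> cell G x6] (run (Do (ACopy 7 6)) s).
Proof.
move=> l6; case: (gs) => _ [_ _ e6 e7 _] lo _; rewrite /= e6 e7 lo /base; last by lia.
by rewrite /low l6; apply: row_state_write.
Qed.

Lemma run_one : S d [eta g with d |-> 1] (run (Do (ACopy 7 12)) s).
Proof.
case: (gs) => -[_ [_ e12 _ _ _]] [_ _ _ e7 _] lo _.
rewrite /= e12 e7 lo /base; last by lia.
by case: lowE => -> _; apply: row_state_write.
Qed.

Lemma run_right :
  S d [eta g with d.+1 |-> 1] (run (seqs [:: Do (IAdd 10 7 2); Do (ACopy 10 12)]) s).
Proof.
case: (gs) => -[[_ e2 _ _ _] [_ e12 _ _ _]] [_ _ _ e7 _] lo _.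
rewrite /= e2 e12 e7 lo /base; last by lia.
case: lowE => -> _; rewrite addn1 -addnS.
by apply: row_state_write; apply: row_state_tmp.
Qed.

Lemma run_left : (0 < d)%N ->
  S d [eta g with d.-1 |-> (-1) ^+ c]
    (run (seqs [:: Do (ISub 10 7 2); Do (ACopy 10 11)]) s).
Proof.
move=> d0; case: (gs) => -[[_ e2 _ _ _] [e11 _ _ _ _]] [_ _ _ e7 _] lo _.
rewrite /= e2 e11 e7 lo /base; last by lia.
case: lowE => _ ->; have -> : (n * n + 2 + d - 1 = base + d.-1)%N by rewrite /base; lia.
by apply: row_state_write; apply: row_state_tmp.
Qed.

Lemma run_down :
  S d [eta g with (d + n.*2.+1)%N |-> (-1) ^+ c]
    (run (seqs [:: Do (IAdd 10 7 13); Do (ACopy 10 11)]) s).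
Proof.
case: (gs) => -[_ [e11 _ e13 _ _]] [_ _ _ e7 _] lo _.
rewrite /= e13 e11 e7 lo /base; last by lia.
case: lowE => _ ->; rewrite -addnA.
by apply: row_state_write; apply: row_state_tmp.
Qed.

Lemma run_up : (n.*2.+1 <= d)%N ->
  S d [eta g with (d - n.*2.+1)%N |-> 1]
    (run (seqs [:: Do (ISub 10 7 13); Do (ACopy 10 12)]) s).
Proof.
move=> hd; case: (gs) => -[_ [_ e12 e13 _ _]] [_ _ _ e7 _] lo _.
rewrite /= e13 e12 e7 lo /base; last by lia.
case: lowE => -> _; rewrite -addnBA //.
by apply: row_state_write; apply: row_state_tmp.
Qed.

Lemma run_next : S (d + N.+1) g (run (Do (IAdd 7 7 9)) s).
Proof.
case: (gs) => -[[? ? ? ? e9] ?] [? ? ? e7 ?] ? ?; split=> //.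
by split=> //=; rewrite e7 e9 addnA.
Qed.
End RowBlocks.

Definition grid_ok m (g : nat -> R) := forall v u, (v < N)%N -> (u < N)%N ->
  g (v * N + u)%N = if (v < m)%N then gentry v u else 0.

Lemma offset_eq v u v' u' : (u < N)%N -> (u' < N)%N ->
  (v * N + u == v' * N + u')%N = (v == v') && (u == u').
Proof.
move=> lu lu'; apply/eqP/andP => [e|[/eqP -> /eqP ->]//].
have N0 : (0 < N)%N by lia.
have ev : v = v'.
  by have /= := congr1 (divn^~ N) e; rewrite !divnMDl // !divn_small ?addn0.
by split; apply/eqP => //; move: e; rewrite ev => /addnI.
Qed.

Lemma grid_okS m g g' : grid_ok m g -> (m < N)%N ->
  (forall v u, (v < N)%N -> (u < N)%N ->
    g' (v * N + u)%N = if v == m then gentry v u else g (v * N + u)%N) ->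
  grid_ok m.+1 g'.
Proof.
move=> ok lm h v u lv lu; rewrite h // ok // ltnS (leq_eqVlt v).
by case: (v == m).
Qed.

Definition row_inv k (s : state R) : Prop :=
  exists2 g, grid_ok k.*2 g &
    row_state (k %/ n).+1 (k %% n).+1 k (k.*2 * N + k.*2) k.+1 g s.

Lemma run_Seq p q (s : state R) : run (Seq p q) s = run q (run p s).
Proof. by []. Qed.

Lemma run_If b p q (s : state R) :
  run (If b p q) s = if holds b s then run p s else run q s.
Proof. by []. Qed.

Definition cell_writes (k : nat) (g : nat -> R) : nat -> R :=
  let d := (k.*2 * N + k.*2)%N in
  let g1 := [eta g with d |-> cell G k] in
  let g2 := if (0 < k %% n)%N then [eta g1 with d.-1 |-> (-1) ^+ c] else g1 in
  if ((k %% n).+1 < n)%N then [eta g2 with d.+1 |-> 1] else g2.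

Definition link_writes (k : nat) (g : nat -> R) : nat -> R :=
  let d := (k.*2.+1 * N + k.*2.+1)%N in
  if (k %% n).+1 == n then [eta g with d |-> 1]
  else if (k %/ n <= k %% n)%N then
    [eta [eta g with d.+1 |-> 1] with (d + n.*2.+1)%N |-> (-1) ^+ c]
  else [eta [eta g with d.-1 |-> (-1) ^+ c] with (d - n.*2.+1)%N |-> 1].

Lemma cell_writes_ok k g : (k < n * n)%N -> grid_ok k.*2 g ->
  grid_ok k.*2.+1 (cell_writes k g).
Proof.
move=> lk ok; have lN : (k.*2.+1 < N)%N by rewrite /N; lia.
apply: (grid_okS ok); first lia.
move=> v u lv lu.
have Ed : (v * N + u == k.*2 * N + k.*2)%N = (v == k.*2) && (u == k.*2).
  by rewrite offset_eq //; lia.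
have EdS : (v * N + u == (k.*2 * N + k.*2).+1)%N = (v == k.*2) && (u == k.*2.+1).
  by rewrite -addnS offset_eq.
have EdP : (0 < k %% n)%N ->
    (v * N + u == (k.*2 * N + k.*2).-1)%N = (v == k.*2) && (u.+1 == k.*2).
  move=> j0; have k0 := leq_trans j0 (leq_mod k n).
  have -> : ((k.*2 * N + k.*2).-1 = k.*2 * N + k.*2.-1)%N.
    by rewrite -!subn1 addnBA // double_gt0.
  have -> : (u.+1 == k.*2) = (u == k.*2.-1) by clear -k0; lia.
  by rewrite offset_eq //; clear -lN; lia.
have ok0 : g (k.*2 * N + u)%N = 0 by rewrite ok ?ltnn //; clear -lN; lia.
have gE : gentry k.*2 u =
    entry c (cell G k) (kind_at n (k %/ n) (k %% n) false k.*2 u).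
  by rewrite /gentry /kind_of odd_double doubleK.
rewrite /cell_writes; case hj: (0 < k %% n)%N; case hj1: ((k %% n).+1 < n)%N => /=;
  rewrite ?EdP // ?EdS Ed; case: eqP => // ->; rewrite gE /kind_at hj hj1 ?andbT ?andbF /=.
all: rewrite ?ok0; clear; move: k.*2 => m.
all: case: (eqVneq u m) => [e|ne] /=; case: (eqVneq u.+1 m) => [e1|ne1] /=;
  case: (eqVneq u m.+1) => [e2|ne2] //=; lia.
Qed.

Lemma link_writes_ok k g : (k < n * n)%N -> grid_ok k.*2.+1 g ->
  grid_ok k.*2.+2 (link_writes k g).
Proof.
move=> lk ok; have lN : (k.*2.+1 < N)%N by rewrite /N; lia.
apply: (grid_okS ok) => // v u lv lu.
have n0 : (0 < n)%N by lia.
have lj : (k %% n < n)%N by rewrite ltn_mod.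
have li : (k %/ n < n)%N by rewrite ltn_divLR.
have ek : k.*2.+1 = vtx n (k %/ n) (k %% n) true.
  by rewrite /vtx -divn_eq addn1.
have gE : gentry k.*2.+1 u =
    entry c (cell G k) (kind_at n (k %/ n) (k %% n) true k.*2.+1 u).
  by rewrite /gentry /kind_of /= odd_double uphalf_double.
rewrite /link_writes; set m := k.*2.+1 in ek gE lN ok *.
have ok0 : g (m * N + u)%N = 0 by rewrite ok ?ltnn.
have E w : (w < N)%N -> (v * N + u == m * N + w)%N = (v == m) && (u == w).
  by move=> lw; rewrite offset_eq.
case hj: ((k %% n).+1 == n).
  by rewrite /= E //; case: eqP => //= ->; rewrite gE ok0 /kind_at hj; case: eqP.
case: (leqP (k %/ n)%N (k %% n)%N) => hij.
  have l1 : (m.+1 < N)%N by rewrite ek vtxAS; apply: vtx_lt; lia.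
  have l2 : (m + n.*2.+1 < N)%N by rewrite ek vtxAD; apply: vtx_lt; lia.
  rewrite /= -addnS -addnA !E //; case: eqP => //= ->.
  rewrite gE ok0 /kind_at hj hij.
  case: (eqVneq u m.+1) => [->|_]; case: eqP => //; lia.
have l1 : (m.-1 < N)%N by lia.
have hn : (n.*2.+1 <= m)%N.
  by rewrite ek /vtx; case: (k %/ n)%N hij => // i _; rewrite mulSn; lia.
have l2 : (m - n.*2.+1 < N)%N by lia.
have -> : ((m * N + m).-1 = m * N + m.-1)%N by lia.
rewrite /= -addnBA // !E //; case: eqP => //= ->.
rewrite gE ok0 /kind_at hj leqNgt hij /=.
have -> : (u.+1 == m) = (u == m.-1) by lia.
have -> : (u + n.*2.+1 == m)%N = (u == m - n.*2.+1)%N by lia.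
case: (eqVneq u m.-1) => [->|_]; case: eqP => //; lia.
Qed.

Lemma run_Skip (s : state R) : run Skip s = s.
Proof. by []. Qed.

Lemma row_step k s : (k < n * n)%N -> row_inv k s -> row_inv k.+1 (run row_body s).
Proof.
move=> lk [g ok S0].
have n0 : (0 < n)%N by lia.
have lN : (k.*2.+1 < N)%N by rewrite /N; lia.
exists (link_writes k (cell_writes k g)).
  by rewrite doubleS; apply: link_writes_ok => //; apply: cell_writes_ok.
have lj : (k %% n < n)%N by rewrite ltn_mod.
have li : (k %/ n < n)%N by rewrite ltn_divLR.
have ek := divn_eq k n.
set d := (k.*2 * N + k.*2)%N in S0.
have ed : (k.*2.+1 * N + k.*2.+1 = d + N.+1)%N by rewrite /d mulSn; lia.
have ed2 : (k.+1.*2 * N + k.+1.*2 = d + N.+1 + N.+1)%N by rewrite /d doubleS !mulSn; lia.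
rewrite ed2 /row_body; cbn [seqs]; rewrite run_Seq.
move: (run_weight S0 lk); move: (run _ s) => {S0}s S0.
rewrite run_Seq.
have {}S0 : row_state (k %/ n).+1 (k %% n).+1 k d k.+1
    (let g1 := [eta g with d |-> cell G k] in
     if (0 < k %% n)%N then [eta g1 with d.-1 |-> (-1) ^+ c] else g1)
    (run (If (TLeq 14 5) (seqs [:: Do (ISub 10 7 2); Do (ACopy 10 11)]) Skip) s).
  case: (S0) => -[_ [_ _ _ e14 _]] [_ e5 _ _ _] _ _.
  rewrite run_If /holds e14 e5 ltnS; case: ltnP => // j0.
  have k0 := leq_trans j0 (leq_mod k n).
  by apply: run_left => //; rewrite /d addn_gt0 double_gt0 k0 orbT.
move: (run _ s) S0 => {}s S0; rewrite run_Seq run_If.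
have -> : holds (TLeq 3 5) s = (n <= (k %% n).+1)%N.
  by case: S0 => -[[_ _ e3 _ _] _] [_ e5 _ _ _] _ _; rewrite /= e3 e5.
rewrite /cell_writes /link_writes -/d ed.
have finish x4 x5 g' s' :
    row_state x4 x5 k (d + N.+1) k.+1 g' s' ->
    x4 = (k.+1 %/ n).+1 -> x5 = (k.+1 %% n).+1 ->
    row_state (k.+1 %/ n).+1 (k.+1 %% n).+1 k.+1 (d + N.+1 + N.+1) k.+2 g'
      (run (seqs [:: Do (IAdd 7 7 9); Do (IAdd 6 6 2); Do (IAdd 16 16 2)]) s').
  move=> S1 e4 e5; cbn [seqs]; rewrite run_Seq -e4 -e5.
  have := run_next S1; move: (run _ s') => s2 {S1}.
  case=> -[[? e2 ? ? ?] ?] [? ? e6 ? e16] ? ?; split=> //.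
  by split=> //=; rewrite ?e6 ?e16 e2 addn1.
case: (leqP n (k %% n).+1) => hj.
  have e : (k %% n).+1 = n by lia.
  have ek1 : k.+1 = ((k %/ n).+1 * n)%N by rewrite mulSn; lia.
  rewrite e eqxx; apply: (@finish (k %/ n).+2 1%N).
  - rewrite run_Seq; move: (run_next S0); move: (run _ s) => {S0}s S0.
    rewrite run_Seq; move: (run_one S0); move: (run _ s) => {S0}s S0.
    case: S0 => -[[? e2 ? ? ?] ?] [e4 ? ? ? ?] ? ?; split=> //.
    by split=> //=; rewrite e4 e2 addn1.
  - by rewrite ek1 mulnK.
  - by rewrite ek1 modnMl.
have ek1 : k.+1 = (k %/ n * n + (k %% n).+1)%N by lia.
have ne : (k %% n).+1 == n = false by lia.
rewrite ne; apply: (@finish (k %/ n).+1 (k %% n).+2).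
- have := run_next (run_right S0); 
  change (seqs [:: Do (IAdd 10 7 2); Do (ACopy 10 12)]) with
    (Seq (Do (IAdd 10 7 2)) (Seq (Do (ACopy 10 12)) Skip)).
  rewrite !(run_Seq, run_If, run_Skip).
  move: (run (Do (IAdd 7 7 9)) _) => {S0}s S0.
  have -> : holds (TLeq 4 5) s = (k %/ n <= k %% n)%N.
    by case: S0 => _ [e4 e5 _ _ _] _ _; rewrite /= e4 e5.
  have finish5 g' s' : row_state (k %/ n).+1 (k %% n).+1 k (d + N.+1) k.+1 g' s' ->
      row_state (k %/ n).+1 (k %% n).+2 k (d + N.+1) k.+1 g' (run (Do (IAdd 5 5 2)) s').
    case=> -[[? e2 ? ? ?] ?] [? e5 ? ? ?] ? ?; split=> //.
    by split=> //=; rewrite e5 e2 addn1.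
  apply: finish5; case: ifP => hij; last first.
    have e : (n.*2.+1 <= d + N.+1)%N.
      have : (n <= n * n)%N by rewrite leq_pmulr.
      by rewrite /N; lia.
    have d0 : (0 < d + N.+1)%N by lia.
    exact: run_up (run_left S0 d0) e.
  exact: run_down (run_right S0).
- by rewrite [in RHS]ek1 divnMDl // (divn_small hj) addn0.
- by rewrite [in RHS]ek1 modnMDl (modn_small hj).
Qed.

Lemma row_loopP s : row_inv 0 s -> exists t s',
  [/\ exec row_loop s t s', (t <= n * n * (psize row_body).+1 + 1)%N
    & row_inv (n * n) s'].
Proof.
apply: exec_while => // [k {}s lk inv|{}s [g _ S0]].
  split; last exact: row_step.
  by case: inv => g _ [[_ [_ _ _ _ e15]] [_ _ _ _ e16] _ _]; rewrite /= e15 e16.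
by case: S0 => -[_ [_ _ _ _ e15]] [_ _ _ _ e16] _ _; rewrite /= e15 e16 ltnn.
Qed.

Lemma init_squareP : square_inv 0 (run init_square (input G)).
Proof. by split=> //; split=> //=; rewrite addn0. Qed.

Lemma init_rowsP s : square_inv n s -> row_inv 0 (run (init_rows c) s).
Proof.
case=> -[e2 e3 e5] e4 e6 ea; exists (fun=> 0); first by [].
have regs_AOpp (x : state R) :
    cnt (run (if c then Do (AOpp 11 11) else Skip) x) = cnt x by case: (c).
rewrite /init_rows; cbn [seqs]; rewrite !run_Seq run_Skip.
set sa := run (Do (AConst 11 true)) _; set sb := run (if c then _ else _) sa.
have eb : cnt sb = cnt sa := regs_AOpp sa.
have ab : aval sb =1 [eta cell G with (n * n).+1 |-> (-1) ^+ c, (n * n)%N |-> 1].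
  move=> a; rewrite /sb; case: (c); rewrite /sa /= ?e2 ?e5 ?e6 ?addn0 ?addn1 ?ea ?eqxx.
    by rewrite expr1; case: eqP.
  by rewrite expr0.
split.
- split; split; rewrite /= ?eb /sa /= ?e2 ?e3 ?e5 ?e6 /base /N; lia.
- split; rewrite /= ?eb /sa /= ?e2 ?e3 ?e5 ?e6 ?div0n ?mod0n /base /N; lia.
- move=> a la; rewrite /= ab /= /low; move: la; rewrite /base => la.
  case: eqP => [->|ne1]; first by rewrite ltnNge leqnSn /= ifF //; lia.
  case: eqP => [->|ne2]; first by rewrite ltnn.
  by rewrite ifT //; lia.
- move=> x; rewrite /= ab /= !ifF; [apply: cell_large| |]; rewrite /base; lia.
Qed.

Lemma reduction_spec : exists t s,
  [/\ exec (reduction c) (input G) t s,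
      (t <= n * 3 + n * n * 100 + 100)%N,
      cnt s 0 = N
    & forall v u : 'I_N, aval s (cnt s 1 + v * N + u)%N = grid_mx c G v u].
Proof.
have [t0 ex0 le0] := @exec_run R init_square (input G) isT.
have [t1 [s1 [ex1 le1 /init_rowsP inv1]]] := square_loopP init_squareP.
have [|t2 ex2 le2] := @exec_run R (init_rows c) s1; first by case: (c).
have [t3 [s3 [ex3 le3 inv3]]] := row_loopP inv1.
pose s4 := run (Do (IConst 5 0)) s3; pose s5 := run (Do (IAdd 0 8 5)) s4.
exists (t0 + (t1 + (t2 + (t3 + (1 + (1 + 0))))))%N, s5; split.
- do 4 (apply: ExecSeq; first eassumption).
  apply: ExecSeq; first exact: ExecDo.
  by apply: ExecSeq; [exact: ExecDo|constructor].
- have : (psize (init_rows c) <= 30)%N by case: (c).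
  move: le0 le1 le2 le3; rewrite /=; lia.
- by case: inv3 => g ok [[[_ _ _ e8 _] _] _ _ _]; rewrite /= e8 addn0.
- case: inv3 => g ok [[[e1 _ _ _ _] _] _ _ hi] v u.
  rewrite /= e1 -addnA hi ok // -/N mxE.
  by have := ltn_ord v; rewrite {2}/N => ->.
Qed.

End Reduction.

Lemma output_transport (R : pzRingType) (s : state R) m (M : 'M[R]_m)
    (P : forall k, 'M[R]_k -> Prop) :
  cnt s 0 = m ->
  (forall i j : 'I_m, aval s (cnt s 1 + i * m + j)%N = M i j) ->
  P m M -> P (cnt s 0) (output s).
Proof.
move=> e; case: m / e M => M h.
by have -> : M = output s by apply/matrixP => i j; rewrite mxE h.
Qed.

Lemma ptime_reduction c (A B : wproblem) :
  (forall (R : pzRingType) n (G : wdigraph R n),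
     instance_of B (grid_mx c G) /\ value_of B (grid_mx c G) = value_of A G) ->
  ptime_many_one A B.
Proof.
move=> AB; have [k hk] := polynomial_bound 4 300.
exists (reduction c), k => R n G _.
have [t [s [ex le e0 out]]] := reduction_spec c G.
exists t, s; have [iB vB] := AB R n G.
have [iB' vB'] : instance_of B (output s) /\ value_of B (output s) = value_of A G.
  pose P k (M : 'M[R]_k) := instance_of B M /\ value_of B M = value_of A G.
  exact: (output_transport (P := P) e0 out).
split=> //; rewrite e0; apply: leq_trans (hk n).
have h1 : (n <= n ^ 4)%N by case: (n) => // m; rewrite -{1}(expn1 m.+1) leq_pexp2l.
have h2 : (n * n <= n ^ 4)%N by case: (n) => // m; rewrite mulnn leq_pexp2l.
have -> : (grid_size n * grid_size n = 4 * n ^ 4)%N by rewrite !expnS expn0; lia.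
lia.
Qed.

Theorem theorem7 :
  ptime_many_one Cperm planar_Cperm /\ ptime_many_one Cdet planar_Cdet.
Proof.
split; [apply: (ptime_reduction (c := false))|apply: (ptime_reduction (c := true))] => R n G.
  split; [exact: planar_grid_mx|exact: perm_grid_mx].
split; [exact: planar_grid_mx|exact: det_grid_mx].
Qed.
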